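(* Let $p>0$, and let $A$ be a compact self-adjoint operator in a Hilbert space such that for some unitary operator $U$ we have $$UAU^*+A\in\mathbf S^0_{p,\infty}.$$ Then $$\Delta_p^+(A)=\Delta_p^-(A)=\tfrac12\Delta_p(A),\qquad \delta_p^+(A)=\delta_p^-(A)=\tfrac12\delta_p(A).$$
   Context: For a compact self-adjoint operator $A$, $\{\lambda_n^+(A)\}_{n\ge1}$ is the non-increasing sequence of positive eigenvalues of $A$, counted with multiplicities and appended by zeros if there are only finitely many; $\lambda_n^-(A)=\lambda_n^+(-A)$. For a compact operator $A$, $s_n(A)=\lambda_n^+(|A|)$, $|A|=\sqrt{A^*A}$, are the singular values. For $p>0$: $\Delta_p(A)=\limsup_{n\to\infty}ns_n(A)^p$, $\delta_p(A)=\liminf_{n\to\infty}ns_n(A)^p$, and for self-adjoint $A$, $\Delta_p^\pm(A)=\limsup_{n\to\infty}n\lambda_n^\pm(A)^p$, $\delta_p^\pm(A)=\liminf_{n\to\infty}n\lambda_n^\pm(A)^p$, with values in $[0,\infty]$. $\mathbf S^0_{p,\infty}$ is the class of compact operators $A$ with $\Delta_p(A)=0$. *)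

(* Defs.v *)
From mathcomp Require Import all_boot all_order all_algebra.
From mathcomp Require Import complex.
From mathcomp Require Import all_classical all_reals all_analysis.

Set Implicit Arguments.
Unset Strict Implicit.
Unset Printing Implicit Defensive.

Import Order.TTheory GRing.Theory Num.Theory Num.Def.
Import numFieldNormedType.Exports.

Local Open Scope classical_set_scope.
Local Open Scope ring_scope.
Local Open Scope complex_scope.
Local Open Scope card_scope.

(* A complex Hilbert space is given by a complete normed space H over R[i]
   together with a positive definite Hermitian form (linear in its first
   argument) which induces the norm of H. *)
Definition hilbert_inner (R : realType) (H : completeNormedModType R[i])
    (dot : {dot H for conjC}) : Prop :=
  forall x : H, `|x| ^+ 2 = dot x x.

Section Operators.
Context {R : realType} {H : completeNormedModType R[i]}.
Implicit Types (dot : {dot H for conjC}) (A B T U : H -> H).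

Definition bounded_operator A : Prop := linear A /\ continuous A.

Definition compact_operator A : Prop :=
  linear A /\ precompact (A @` [set x | `|x| <= 1]).

(* [get] is the choice operator: [adjoint dot A] is the adjoint of A whenever
   one exists, in particular for every bounded A; it is then unique. *)
Definition adjoint dot A : H -> H :=
  get [set B : H -> H | forall x y, dot (A x) y = dot x (B y)].

Definition selfadjoint dot A : Prop :=
  forall x y, dot (A x) y = dot x (A y).

Definition unitary dot U : Prop :=
  [/\ bounded_operator U,
      adjoint dot U \o U = id &
      U \o adjoint dot U = id].

(* The order of R[i] makes [0 <= z] mean that z is real and nonnegative. *)
Definition nonneg_operator dot T : Prop :=
  [/\ bounded_operator T, selfadjoint dot T & forall x, 0 <= dot (T x) x].

Definition sqrt_operator dot B : H -> H :=
  get [set T : H -> H | nonneg_operator dot T /\ T \o T = B].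

Definition abs_operator dot A : H -> H :=
  sqrt_operator dot (adjoint dot A \o A).

Definition eigenspace_at A (t : R) : set H := [set x | A x = t%:C *: x].

Definition has_dim (V : set H) (d : nat) : Prop :=
  exists e : 'I_d -> H,
    [/\ forall i, V (e i),
        forall c : 'I_d -> R[i], \sum_i c i *: e i = 0 -> forall i, c i = 0 &
        forall x, V x -> exists c : 'I_d -> R[i], x = \sum_i c i *: e i].

(* l lists in non-increasing order the positive eigenvalues of A, each t > 0
   occurring dim ker (A - t) times (possibly 0 times); the entries that are
   not positive eigenvalues are zeros.  Only finitely many terms of l precede
   any given one, so zeros can occur only if A has finitely many positive
   eigenvalues. *)
Definition is_pos_eigenvalue_seq A (l : nat -> R) : Prop :=
  [/\ forall m n, (m <= n)%N -> l n <= l m,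
      forall n, 0 <= l n &
      forall t, 0 < t -> exists d : nat,
        has_dim (eigenspace_at A t) d /\ [set n | l n = t] #= `I_d].

(* Indices start at 0: [lambda_plus A n] is the (n+1)-st positive eigenvalue,
   and likewise for [lambda_minus] and [sing_val]. *)
Definition lambda_plus A : nat -> R :=
  get [set l : nat -> R | is_pos_eigenvalue_seq A l].

Definition lambda_minus A : nat -> R := lambda_plus (fun x => - A x).

Definition sing_val dot A : nat -> R := lambda_plus (abs_operator dot A).

(* The upper and lower limits of n l_n^p, where l_n (n >= 1) is [l n.-1]. *)
Definition upper_asymp (p : R) (l : nat -> R) : \bar R :=
  limn_esup (fun n : nat => (n.+1%:R * l n `^ p)%:E).

Definition lower_asymp (p : R) (l : nat -> R) : \bar R :=
  limn_einf (fun n : nat => (n.+1%:R * l n `^ p)%:E).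

Definition Delta dot (p : R) A : \bar R := upper_asymp p (sing_val dot A).
Definition delta dot (p : R) A : \bar R := lower_asymp p (sing_val dot A).

Definition Delta_plus (p : R) A : \bar R := upper_asymp p (lambda_plus A).
Definition delta_plus (p : R) A : \bar R := lower_asymp p (lambda_plus A).

Definition Delta_minus (p : R) A : \bar R := upper_asymp p (lambda_minus A).
Definition delta_minus (p : R) A : \bar R := lower_asymp p (lambda_minus A).

Definition S0 dot (p : R) : set (H -> H) :=
  [set A | compact_operator A /\ Delta dot p A = 0%E].

End Operators.

(* Main.v *)
(** The eigenvectors of [A] with eigenvalue at least [t > 0] span a space on
which [<A x, x> >= t |x|^2], and orthogonally to them [<A x, x> <= t |x|^2].
Writing [A = K - U A U^*] with [K] in [S^0_{p,oo}] and counting dimensions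
yields the Weyl-type bounds
[lambda^+_{n+m}(A) <= lambda^-_n(A) + s_m(K)] and its mirror image, while the
singular values of [A] are the union of [lambda^+] and [lambda^-].  Taking [m]
to be a small proportion of [n], the term [s_m(K) = o(m^{-1/p})] becomes
negligible, hence [lambda^+] and [lambda^-] have the same asymptotics and each
accounts for half of the singular values.

The eigenvalues themselves are obtained greedily: the supremum of [<A x, x>] on
the orthogonal complement of the eigenvectors found so far is attained, by
compactness, at a new eigenvector. *)
Require Import Defs.
From mathcomp Require Import all_boot all_order all_algebra.
From mathcomp Require Import complex finmap.
From mathcomp Require Import all_classical all_reals all_analysis.
From mathcomp Require Import ring lra zify.
Import Order.TTheory GRing.Theory Num.Theory Num.Def.
Import numFieldNormedType.Exports.
Local Open Scope classical_set_scope.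
Local Open Scope ring_scope.
Local Open Scope complex_scope.

Set Implicit Arguments.
Unset Strict Implicit.
Unset Printing Implicit Defensive.

(** [adjoint], [sqrt_operator] and [lambda_plus] are choices made by [get]; they say nothing until a
    witness is exhibited, and an eigenvalue sequence must also be shown unique. This is why a
    variational adjoint of [U], a spectral square root of [A \o A] and a multiplicity argument
    surround the Weyl-type bounds. The absolute value enters through its positivity and the identity
    [||A| x| = |A x|]; its eigenvectors are never matched with those of [A]. The union of the two
    eigenvalue sequences is therefore expressed by two dimension counts, with zero-based indices:
    [s_{n+m} <= max (lambda^+_n, lambda^-_m)] and [min (lambda^+_n, lambda^-_m) <= s_{n+m+1}]. The
    limits lie in [[0, +oo]], so comparisons are made against real thresholds above the limit. The
    proportion given to the error index is fixed by an integer [q], chosen from the threshold before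
    any index tends to infinity. *)

(** * Upper and lower limits with extended real values *)

Section ExtendedLimits.
Context {R : realType}.
Implicit Types (u : nat -> \bar R) (C : \bar R).

Lemma limn_esup_ltP u C : (limn_esup u < C)%E ->
  exists N, forall n, (N <= n)%N -> (u n < C)%E.
Proof.
rewrite /limn_esup /limf_esup => /ereal_inf_lt[_ [D [N _ DN] <-]] DC.
exists N => n Nn; apply: le_lt_trans DC; apply: ereal_sup_ubound.
by exists n => //; apply: DN.
Qed.

Lemma limn_esup_le u C N : (forall n, (N <= n)%N -> (u n <= C)%E) ->
  (limn_esup u <= C)%E.
Proof.
move=> uC; apply: le_trans (_ : ereal_sup (u @` [set n | (N <= n)%N]) <= C)%E.
  apply: ereal_inf_lbound; exists [set n | (N <= n)%N] => //.
  by exists N.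
by apply: ge_ereal_sup => _ [n Nn <-]; apply: uC.
Qed.

Lemma limn_einf_ltP u C N : (limn_einf u < C)%E ->
  exists n, (N <= n)%N /\ (u n < C)%E.
Proof.
move=> uC; apply: contrapT => nex; move: uC; apply/negP; rewrite -leNgt.
rewrite /limn_einf leeNr; apply: (@limn_esup_le _ _ N) => n Nn.
rewrite leeN2 leNgt; apply/negP => unC; apply: nex; by exists n.
Qed.

Lemma limn_einf_le u C : (forall N, exists n, (N <= n)%N /\ (u n <= C)%E) ->
  (limn_einf u <= C)%E.
Proof.
move=> uC; rewrite leNgt; apply/negP; rewrite /limn_einf lteNr.
move=> /limn_esup_ltP[N uN]; have [n [Nn unC]] := uC N.
by have := uN n Nn; rewrite lteN2 ltNge unC.
Qed.

(** An infinite [y] makes the right side infinite, as [c > 0]. For finite [y] half of the allowed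
    error, divided by [c], lifts the threshold [C] strictly above [y]; the other half is the [e] of
    the hypothesis. *)
Lemma lee_scaled_bound (x y : \bar R) (c : R) : 0 < c -> (0 <= y)%E ->
  (forall C e : R, 0 <= C -> 0 < e -> (y < C%:E)%E -> (x <= (c * C + e)%:E)%E) ->
  (x <= c%:E * y)%E.
Proof.
move=> c0 y0 H; case: y y0 H => [r||] // y0 H; last first.
  by rewrite gt0_muley ?leey.
apply/lee_addgt0Pr => e e0.
have r0 : 0 <= r by rewrite -lee_fin.
apply: le_trans (H (r + e / (2 * c)) (e / 2) _ _ _) _.
- by rewrite addr_ge0// divr_ge0 ?ltW ?mulr_gt0.
- by rewrite divr_gt0.
- by rewrite lte_fin ltrDl divr_gt0 ?mulr_gt0.
- rewrite -EFinM -EFinD lee_fin mulrDr -addrA.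
  by rewrite (_ : c * (e / (2 * c)) + e / 2 = e) //; field; rewrite gt_eqF.
Qed.

End ExtendedLimits.

(** * Comparison of power asymptotics under a negligible perturbation *)

Section AsymptoticComparison.
Context {R : realType}.
Variables (p : R) (hp : 0 < p).
Implicit Types (x y k : nat -> R).

Lemma powRK_inv (a : R) : 0 <= a -> (a `^ p^-1) `^ p = a.
Proof. by move=> a0; rewrite -powRrM mulVf ?gt_eqF// powRr1. Qed.

Lemma powRVK (a : R) : 0 <= a -> (a `^ p) `^ p^-1 = a.
Proof. by move=> a0; rewrite -powRrM mulfV ?gt_eqF// powRr1. Qed.

Lemma ge0_ler_powR2 (r a b : R) : 0 <= r -> 0 <= a -> a <= b -> a `^ r <= b `^ r.
Proof.
move=> r0 a0 ab; apply: ge0_ler_powR => //; rewrite nnegrE //.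
exact: le_trans ab.
Qed.

Lemma upper_asymp_eq0 k : (forall n, 0 <= k n) -> upper_asymp p k = 0%E ->
  forall e, 0 < e -> exists M, forall m, (M <= m)%N -> m.+1%:R * k m `^ p <= e.
Proof.
move=> k0 uk e e0; have /limn_esup_ltP[M hM] : (upper_asymp p k < e%:E)%E.
  by rewrite uk lte_fin.
by exists M => m Mm; have := hM m Mm; rewrite lte_fin => /ltW.
Qed.

(* The error [k] is measured at an index proportional to [N], so it is absorbed
   in the gap between [(c C + e / 2)^(1/p)] and [(c C + e)^(1/p)]. *)
Lemma perturbed_weight_le x y k (c C e : R) :
  (forall n, 0 <= x n) -> (forall n, 0 <= y n) -> (forall n, 0 <= k n) ->
  upper_asymp p k = 0%E -> 0 < c -> 0 <= C -> 0 < e ->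
  exists q, (0 < q)%N /\ forall q', (0 < q')%N -> exists M, forall N j m,
    (M <= m)%N -> q%:R * N.+1%:R <= q.+1%:R * c * j.+1%:R :> R ->
    (N.+1 <= q' * m.+1)%N -> x N <= y j + k m ->
    j.+1%:R * y j `^ p <= C -> N.+1%:R * x N `^ p <= c * C + e.
Proof.
move=> x0 y0 k0 uk c0 C0 e0.
have cC0 : 0 <= c * C by rewrite mulr_ge0// ltW.
(* Matching indices costs a factor [1 + 1/q]; this [q] keeps [(1 + 1/q) c C] below [c C + e/2]. *)
have [q qC] : exists q : nat, 2 * (c * C) / e < q%:R.
  exists (Num.truncn (2 * (c * C) / e)).+1; exact: truncnS_gt.
have q0 : (0 < q)%N.
  by rewrite -(ltr_nat R); apply: le_lt_trans qC; rewrite divr_ge0 ?mulr_ge0// ltW.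
exists q; split=> // q' q'0.
have q0R : 0 < q%:R :> R by rewrite ltr0n.
have q'0R : 0 < q'%:R :> R by rewrite ltr0n.
pose g := (c * C + e) `^ p^-1 - (c * C + e / 2) `^ p^-1.
have g0 : 0 < g.
  rewrite subr_gt0; apply: gt0_ltr_powR; rewrite ?invr_gt0// ?nnegrE; lra.
(* Since [N + 1 <= q' (m + 1)], the bound [g^p / q'] at index [m] becomes [g^p] at index [N]. *)
have [|M hM] := @upper_asymp_eq0 k k0 uk (g `^ p / q'%:R).
  by rewrite divr_gt0// powR_gt0.
exists M => N j m Mm hN hm xN yj.
have N0 : 0 <= N.+1%:R :> R by [].
have j0 : 0 < j.+1%:R :> R by [].
have m0 : 0 < m.+1%:R :> R by [].
have Y : N.+1%:R `^ p^-1 * y j <= (c * C + e / 2) `^ p^-1.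
  rewrite -{1}(powRVK (y0 j)) -powRM ?powR_ge0//.
  apply: ge0_ler_powR2; rewrite ?invr_ge0 ?(ltW hp) ?mulr_ge0 ?powR_ge0//.
  have : q%:R * (N.+1%:R * y j `^ p) <= q.+1%:R * c * C.
    rewrite mulrA; apply: le_trans (_ : q.+1%:R * c * j.+1%:R * y j `^ p <= _).
      by rewrite ler_wpM2r ?powR_ge0.
    by rewrite -mulrA ler_wpM2l// mulr_ge0// ltW.
  have qC' : 2 * (c * C) < q%:R * e by rewrite -ltr_pdivrMr.
  move=> h; rewrite -(ler_pM2l q0R); apply: le_trans h _.
  rewrite -natr1; nra.
have K : N.+1%:R `^ p^-1 * k m <= g.
  rewrite -{1}(powRVK (k0 m)) -powRM ?powR_ge0//.
  rewrite -(powRVK (ltW g0)).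
  apply: ge0_ler_powR2; rewrite ?invr_ge0 ?(ltW hp) ?mulr_ge0 ?powR_ge0//.
  have hm' : N.+1%:R <= q'%:R * m.+1%:R :> R by rewrite -natrM ler_nat.
  apply: le_trans (_ : q'%:R * m.+1%:R * k m `^ p <= _).
    by rewrite ler_wpM2r ?powR_ge0.
  by rewrite -mulrA mulrC -ler_pdivlMr// hM.
have X : N.+1%:R `^ p^-1 * x N <= (c * C + e) `^ p^-1.
  apply: le_trans (_ : N.+1%:R `^ p^-1 * (y j + k m) <= _).
    by rewrite ler_wpM2l ?powR_ge0.
  by rewrite mulrDr; rewrite /g in K; lra.
have ce : 0 <= c * C + e by lra.
rewrite -(powRK_inv ce) -{1}(powRK_inv N0) -powRM ?powR_ge0//.
by apply: ge0_ler_powR2; rewrite ?(ltW hp) ?mulr_ge0 ?powR_ge0.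
Qed.

Lemma upper_asymp_ge0 x : (0 <= upper_asymp p x)%E.
Proof.
rewrite leNgt; apply/negP => /limn_esup_ltP[N /(_ N (leqnn _))].
by rewrite lte_fin ltNge mulr_ge0 ?powR_ge0.
Qed.

Lemma lower_asymp_ge0 x : (0 <= lower_asymp p x)%E.
Proof.
rewrite leNgt; apply/negP => /(@limn_einf_ltP _ _ _ 0)[N [_]].
by rewrite lte_fin ltNge mulr_ge0 ?powR_ge0.
Qed.

(** The first condition is [N + 1 <= (1 + 1/q) c (j + 1)] cleared of denominators. The second keeps
    [m] above a fixed proportion of [N], so that [k m] is negligible at the scale of [N]. *)
Definition index_matched x y k (c : R) (q q' N j m : nat) : Prop :=
  [/\ q%:R * N.+1%:R <= q.+1%:R * c * j.+1%:R :> R,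
      (N.+1 <= q' * m.+1)%N & x N <= y j + k m].

(** A threshold above the upper limit of [y] controls all late [j], and all late [N] must be
    bounded: the match goes from each [N] to some [j]. *)
Lemma upper_asymp_compare x y k c :
  (forall n, 0 <= x n) -> (forall n, 0 <= y n) -> (forall n, 0 <= k n) ->
  upper_asymp p k = 0%E -> 0 < c ->
  (forall q, (0 < q)%N -> exists q', (0 < q')%N /\
    forall N, exists j m, index_matched x y k c q q' N j m) ->
  (upper_asymp p x <= c%:E * upper_asymp p y)%E.
Proof.
move=> x0 y0 k0 uk c0 H; apply: lee_scaled_bound => //.
  exact: upper_asymp_ge0.
move=> C e C0 e0 /limn_esup_ltP[J hJ].
have [q [q0 hq]] := perturbed_weight_le x0 y0 k0 uk c0 C0 e0.
have [q' [q'0 hN]] := H q q0; have [M hM] := hq q' q'0.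
(* As [1 + 1/q <= 2], a match gives [N + 1 <= 2 c (j + 1)]; so [N >= B] forces [j > J], and the
   summand [q' * M.+1] forces [m >= M]. *)
pose B := (Num.truncn (2 * c * J.+1%:R)).+1.
apply: (@limn_esup_le _ _ _ (B + q' * M.+1)%N) => N hBN.
have [j [m [h1 h2 h3]]] := hN N.
rewrite lee_fin; apply: (hM N j m) => //.
  have : (q' * M.+1 <= q' * m.+1)%N by lia.
  by rewrite leq_pmul2l.
rewrite ltW // -lte_fin hJ //.
have hB : 2 * c * J.+1%:R < N.+1%:R.
  apply: lt_le_trans (truncnS_gt _) _; rewrite ler_nat -/B; lia.
have : 2 * c * J.+1%:R < 2 * c * j.+1%:R.
  apply: lt_le_trans hB _.
  have q0R : 0 < q%:R :> R by rewrite ltr0n.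
  rewrite -(ler_pM2l q0R); apply: le_trans h1 _.
  rewrite mulrA ler_wpM2r // [q%:R * _]mulrA ler_wpM2r ?(ltW c0)//.
  by rewrite -natrM ler_nat; lia.
rewrite ltr_pM2l ?mulr_gt0// ltr_nat; lia.
Qed.

(** A threshold above the lower limit of [y] only provides some arbitrarily late [j], so the match
    goes from [j] to [N]. The condition [j <= 2 (N + 1)] makes the resulting [N] arbitrarily late
    too. *)
Lemma lower_asymp_compare x y k c :
  (forall n, 0 <= x n) -> (forall n, 0 <= y n) -> (forall n, 0 <= k n) ->
  upper_asymp p k = 0%E -> 0 < c ->
  (forall q, (0 < q)%N -> exists q' J, (0 < q')%N /\
    forall j, (J <= j)%N -> exists N m, (j <= N.+1 * 2)%N /\
       index_matched x y k c q q' N j m) ->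
  (lower_asymp p x <= c%:E * lower_asymp p y)%E.
Proof.
move=> x0 y0 k0 uk c0 H; apply: lee_scaled_bound => //.
  exact: lower_asymp_ge0.
move=> C e C0 e0 hC.
have [q [q0 hq]] := perturbed_weight_le x0 y0 k0 uk c0 C0 e0.
have [q' [J [q'0 hN]]] := H q q0; have [M hM] := hq q' q'0.
apply: limn_einf_le => B.
have [j [hj yj]] := limn_einf_ltP (J + B.+1 * 2 + (q' * M.+1) * 2) hC.
have [|N [m [jN [h1 h2 h3]]]] := hN j; first lia.
exists N; split; first lia.
rewrite lee_fin; apply: (hM N j m) => //; last by rewrite ltW // -lte_fin.
have : (q' * M.+1 <= q' * m.+1)%N by lia.
by rewrite leq_pmul2l.
Qed.

Lemma asymp_le_shift x y k :
  (forall n, 0 <= x n) -> (forall n, 0 <= y n) -> (forall n, 0 <= k n) ->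
  upper_asymp p k = 0%E -> (forall n m, x (n + m)%N <= y n + k m) ->
  (upper_asymp p x <= upper_asymp p y)%E /\
  (lower_asymp p x <= lower_asymp p y)%E.
Proof.
move=> x0 y0 k0 uk xyk.
rewrite -[upper_asymp p y]mul1e -[lower_asymp p y]mul1e; split.
(* The error takes a share [1/(q + 1)] of [N]; what is left is [j], with
   [N + 1 <= (1 + 1/q) (j + 1)]. In the converse direction the error index is a share [1/q] of
   [j]. *)
- apply: (upper_asymp_compare x0 y0 k0 uk) => // q q0; exists q.+1; split=> // N.
  have := leq_trunc_div N q.+1; have := ltn_ceil N (ltn0Sn q).
  set m := (N %/ q.+1)%N => h1 h2; exists (N - m)%N, m; split.
  + rewrite mulr1 -!natrM ler_nat; nia.
  + nia.
  + by have := xyk (N - m)%N m; rewrite subnK//; nia.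
- apply: (lower_asymp_compare x0 y0 k0 uk) => // q q0.
  exists q.+1, 0%N; split=> // j _.
  have := leq_trunc_div j q; have := ltn_ceil j q0.
  set m := (j %/ q)%N => h1 h2; exists (j + m)%N, m; split; first lia; split.
  + rewrite mulr1 -!natrM ler_nat; nia.
  + nia.
  + exact: xyk.
Qed.

Lemma asymp_le_double x y k :
  (forall n, 0 <= x n) -> (forall n, 0 <= y n) -> (forall n, 0 <= k n) ->
  upper_asymp p k = 0%E -> (forall n m, x (n.*2 + m)%N <= y n + k m) ->
  (upper_asymp p x <= 2%:E * upper_asymp p y)%E /\
  (lower_asymp p x <= 2%:E * lower_asymp p y)%E.
Proof.
move=> x0 y0 k0 uk xyk; split.
- apply: (upper_asymp_compare x0 y0 k0 uk) => // q q0; exists q.+1; split=> // N.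
  have := leq_trunc_div N q.+1; have := ltn_ceil N (ltn0Sn q).
  set m := (N %/ q.+1)%N => h1 h2.
  have h3 : ((N - m)./2.*2 <= N - m)%N by lia.
  have h4 : (N - m <= (N - m)./2.*2.+1)%N by lia.
  have h5 : (m <= N)%N by nia.
  move: h3 h4; set n := (N - m)./2 => h3 h4.
  (* Parity is absorbed by the error index: it becomes [N - 2 n], which is [m] or [m + 1]. *)
  exists n, (N - n.*2)%N; split.
  + rewrite -!natrM ler_nat -?muln2; rewrite -?muln2 in h3 h4; nia.
  + rewrite -?muln2; rewrite -?muln2 in h3 h4; nia.
  + by have := xyk n (N - n.*2)%N; rewrite subnKC//; lia.
- apply: (lower_asymp_compare x0 y0 k0 uk) => // q q0.
  exists (q.*2.+1), 0%N; split=> // j _.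
  have := leq_trunc_div j q; have := ltn_ceil j q0.
  set m := (j %/ q)%N => h1 h2; exists (j.*2 + m)%N, m; split; first lia; split.
  + rewrite -!natrM ler_nat -?muln2; nia.
  + rewrite -?muln2; nia.
  + exact: xyk.
Qed.

(** Counted from one, [n.*2.+1] is the index [2 (n + 1)], so the factor is exactly one half. For the
    lower limit the given [j] has arbitrary parity, and monotonicity of [y] passes from
    [2 (j./2) + 1] to [j]. *)
Lemma asymp_le_half x y k :
  (forall n, 0 <= x n) -> (forall n, 0 <= y n) -> (forall n, 0 <= k n) ->
  (forall m n, (m <= n)%N -> y n <= y m) ->
  upper_asymp p k = 0%E -> (forall n m, x (n + m)%N <= y n.*2.+1 + k m) ->
  (upper_asymp p x <= 2^-1%:E * upper_asymp p y)%E /\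
  (lower_asymp p x <= 2^-1%:E * lower_asymp p y)%E.
Proof.
move=> x0 y0 k0 ymono uk xyk; have h2R : 0 < 2^-1 :> R by rewrite invr_gt0.
split.
- apply: (upper_asymp_compare x0 y0 k0 uk) => // q q0; exists q.+1; split=> // N.
  have := leq_trunc_div N q.+1; have := ltn_ceil N (ltn0Sn q).
  set m := (N %/ q.+1)%N => h1 h2; exists (N - m).*2.+1, m; split.
  + rewrite mulrAC ler_pdivlMr// -!natrM ler_nat -?muln2; nia.
  + nia.
  + by have := xyk (N - m)%N m; rewrite subnK//; nia.
- apply: (lower_asymp_compare x0 y0 k0 uk) => // q q0.
  (* For even [j] the index [2 (j./2 + 1)] exceeds [j + 1] by one. Taking [j >= 2 q] and only the
     share [1/(2 q)] for the error leaves room for this inside the factor [1 + 1/q]. *)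
  exists (q.*2.+1), q.*2; split=> // j jq.
  have q20 : (0 < q.*2)%N by lia.
  have := leq_trunc_div j./2 q.*2; have := ltn_ceil j./2 q20.
  have h3 : (j./2.*2 <= j)%N by lia.
  have h4 : (j <= j./2.*2.+1)%N by lia.
  move: h3 h4; set n := j./2.
  set m := (n %/ q.*2)%N => h3 h4 h1 h2; exists (n + m)%N, m.
  split; first lia; split.
  + rewrite mulrAC ler_pdivlMr// -!natrM ler_nat.
    rewrite -?muln2 in h1 h2 h3 h4 jq q20 *; nia.
  + rewrite -?muln2 in h1 h2 h3 h4 jq q20 *; nia.
  + by apply: le_trans (xyk n m) _; rewrite lerD2r; apply: ymono.
Qed.

(** Uneven splittings bring in the error. Cutting the index of [s] as [(n + m) + n] pairs
    [l1 (n + m)], at most [l2 n + k m], with [l2 n], so [s] is at most twice [l2]. Conversely the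
    minimum of [l1 n] and [l2 (n + m)] lies below [s (2 n + 1)] by monotonicity, and [l2 (n + m)]
    exceeds it by at most [k m]. *)
Lemma asymp_balance l1 l2 s k :
  (forall n, 0 <= l1 n) -> (forall n, 0 <= l2 n) -> (forall n, 0 <= s n) ->
  (forall n, 0 <= k n) -> (forall m n, (m <= n)%N -> s n <= s m) ->
  upper_asymp p k = 0%E ->
  (forall n m, l1 (n + m)%N <= l2 n + k m) ->
  (forall n m, l2 (n + m)%N <= l1 n + k m) ->
  (forall n m, s (n + m)%N <= maxr (l1 n) (l2 m)) ->
  (forall n m, minr (l1 n) (l2 m) <= s (n + m).+1) ->
  [/\ upper_asymp p l1 = upper_asymp p l2,
      upper_asymp p l2 = ((2^-1)%:E * upper_asymp p s)%E,
      lower_asymp p l1 = lower_asymp p l2 &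
      lower_asymp p l2 = ((2^-1)%:E * lower_asymp p s)%E].
Proof.
move=> l10 l20 s0 k0 smono uk l12 l21 smax smin.
have [U12 L12] := asymp_le_shift l10 l20 k0 uk l12.
have [U21 L21] := asymp_le_shift l20 l10 k0 uk l21.
have [|Us Ls] := asymp_le_double s0 l20 k0 uk.
  move=> n m; apply: le_trans (_ : maxr (l1 (n + m)%N) (l2 n) <= _).
    by have := smax (n + m)%N n; rewrite addnAC addnn.
  by rewrite ge_max l12 lerDl k0.
have [|Uh Lh] := asymp_le_half l20 s0 k0 smono uk.
  move=> n m; have := smin n (n + m)%N; rewrite ge_min.
  have smn : s (n + (n + m)).+1 <= s n.*2.+1 by apply: smono; lia.
  by have := l21 n m; have := k0 m => ? ? /orP[]; lra.
have half (a b : \bar R) : (a <= 2%:E * b)%E -> (b <= 2^-1%:E * a)%E ->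
    b = (2^-1%:E * a)%E.
  move=> ab ba; apply/eqP; rewrite eq_le ba /=.
  have -> : b = (2^-1%:E * (2%:E * b))%E by rewrite muleA -EFinM mulVf// mul1e.
  by rewrite lee_pmul2l// lte_fin invr_gt0.
by split; [apply/eqP; rewrite eq_le U12 | exact: half
  | apply/eqP; rewrite eq_le L12 | exact: half].
Qed.

End AsymptoticComparison.

(** * Elementary rules for linear maps *)

Section LinearMaps.
Context {K : pzRingType} {V W : lmodType K}.
Variable (A : V -> W).
Hypothesis hA : linear A.

Lemma lin_add x y : A (x + y) = A x + A y.
Proof. by have := hA 1 x y; rewrite !scale1r. Qed.

Lemma lin_zero : A 0 = 0.
Proof. by apply: (addrI (A 0)); rewrite -lin_add !addr0. Qed.

Lemma lin_scale a x : A (a *: x) = a *: A x.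
Proof. by have := hA a x 0; rewrite !addr0 lin_zero addr0. Qed.

Lemma lin_opp x : A (- x) = - A x.
Proof. by rewrite -scaleN1r lin_scale scaleN1r. Qed.

Lemma lin_sub x y : A (x - y) = A x - A y.
Proof. by rewrite lin_add lin_opp. Qed.

Lemma lin_sum (I : Type) (r : seq I) (P : pred I) (F : I -> V) :
  A (\sum_(i <- r | P i) F i) = \sum_(i <- r | P i) A (F i).
Proof. exact: (big_morph A lin_add lin_zero). Qed.

End LinearMaps.

(** * Real parts of complex scalars *)

Section RealComplex.
Context {R : realType}.
Implicit Types (z w : R[i]) (r : R).

Lemma ReD z w : complex.Re (z + w) = complex.Re z + complex.Re w.
Proof. by case: z w => [a b] [c d]. Qed.

Lemma ReN z : complex.Re (- z) = - complex.Re z.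
Proof. by case: z. Qed.

Lemma ReM_real r z : complex.Re (r%:C * z) = r * complex.Re z.
Proof. by case: z => a b; rewrite /= mul0r subr0. Qed.

Lemma Re_conj z : complex.Re (z^*)%C = complex.Re z.
Proof. by case: z. Qed.

Lemma conjC_conjc z : conjC z = (z^*)%C.
Proof. by []. Qed.

Lemma ge0_ReE z : 0 <= z -> z = (complex.Re z)%:C.
Proof. by case: z => a b; rewrite lecE /= => /andP[/eqP -> _]. Qed.

End RealComplex.

(** * The underlying real inner product space, boundedness and convergence *)

Section RealInnerProduct.
Context {R : realType} {H : completeNormedModType R[i]}.
Variables (dot : {dot H for conjC}) (hdot : hilbert_inner dot).
Implicit Types (x y z : H) (r : R).

(** Norms take values in [R[i]], whose order is partial. Estimates are carried out with real parts,
    and [rdot_ext] leads back to [dot]. *)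
Definition rnorm x : R := complex.Re `|x|.
Definition rdot x y : R := complex.Re (dot x y).

Lemma normr_rnorm x : `|x| = (rnorm x)%:C.
Proof. exact: (ge0_ReE (normr_ge0 x)). Qed.

Lemma rnorm_ge0 x : 0 <= rnorm x.
Proof. by have := normr_ge0 x; rewrite normr_rnorm lecR. Qed.

Lemma rnorm0 : rnorm 0 = 0.
Proof. by rewrite /rnorm normr0. Qed.

Lemma rnorm_eq0 x : rnorm x = 0 -> x = 0.
Proof. by move=> h; apply/eqP; rewrite -normr_eq0 normr_rnorm h. Qed.

Lemma rnorm_gt0 x : x <> 0 -> 0 < rnorm x.
Proof.
by move=> x0; rewrite lt_def rnorm_ge0 andbT; apply/eqP => /rnorm_eq0.
Qed.

Lemma ler_rnormD x y : rnorm (x + y) <= rnorm x + rnorm y.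
Proof. by rewrite -lecR rmorphD /= -!normr_rnorm ler_normD. Qed.

Lemma rnormN x : rnorm (- x) = rnorm x.
Proof. by rewrite /rnorm normrN. Qed.

Lemma rnormBC x y : rnorm (x - y) = rnorm (y - x).
Proof. by rewrite -rnormN opprB. Qed.

Lemma rnorm_realZ r x : rnorm (r%:C *: x) = `|r| * rnorm x.
Proof.
by rewrite /rnorm normrZ normc_def /= expr0n addr0 sqrtr_sqr ReM_real.
Qed.

Lemma dotDl x y z : dot (x + y) z = dot x z + dot y z.
Proof. by rewrite linearDl. Qed.
Lemma dotDr x y z : dot z (x + y) = dot z x + dot z y.
Proof. by rewrite linearDr. Qed.
Lemma dotZl a x z : dot (a *: x) z = a * dot x z.
Proof. by rewrite linearZl_LR. Qed.
Lemma dotZr a x z : dot z (a *: x) = conjC a * dot z x.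
Proof. by rewrite linearZr_LR. Qed.
Lemma dotNl x z : dot (- x) z = - dot x z.
Proof. by rewrite linearNl. Qed.
Lemma dotNr x z : dot z (- x) = - dot z x.
Proof. by rewrite linearNr. Qed.
Lemma dotBl x y z : dot (x - y) z = dot x z - dot y z.
Proof. by rewrite linearBl. Qed.
Lemma dotBr x y z : dot z (x - y) = dot z x - dot z y.
Proof. by rewrite linearBr. Qed.
Lemma dot0l z : dot 0 z = 0.
Proof. by rewrite linear0l. Qed.
Lemma dot0r z : dot z 0 = 0.
Proof. by rewrite linear0r. Qed.
Lemma dot_conj x y : dot x y = conjC (dot y x).
Proof. by rewrite hermC mul1r. Qed.
Lemma dot_sym0 x y : dot x y = 0 -> dot y x = 0.
Proof. by move=> h; rewrite dot_conj h conjC0. Qed.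

Lemma dot_suml (I : Type) (r : seq I) (P : pred I) (F : I -> H) z :
  dot (\sum_(i <- r | P i) F i) z = \sum_(i <- r | P i) dot (F i) z.
Proof.
exact: (big_morph (fun x => dot x z) (fun x y => dotDl x y z) (dot0l z)).
Qed.

Lemma dot_sumr (I : Type) (r : seq I) (P : pred I) (F : I -> H) z :
  dot z (\sum_(i <- r | P i) F i) = \sum_(i <- r | P i) dot z (F i).
Proof.
exact: (big_morph (dot z) (fun x y => dotDr x y z) (dot0r z)).
Qed.

Lemma dot_self x : dot x x = (rnorm x ^+ 2)%:C.
Proof. by rewrite -hdot normr_rnorm rmorphXn. Qed.

Lemma rdot_self x : rdot x x = rnorm x ^+ 2.
Proof. by rewrite /rdot dot_self. Qed.

Lemma rdotC x y : rdot x y = rdot y x.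
Proof. by rewrite /rdot dot_conj conjC_conjc Re_conj. Qed.
Lemma rdotDl x y z : rdot (x + y) z = rdot x z + rdot y z.
Proof. by rewrite /rdot dotDl ReD. Qed.
Lemma rdotDr x y z : rdot z (x + y) = rdot z x + rdot z y.
Proof. by rewrite /rdot dotDr ReD. Qed.
Lemma rdotNl x z : rdot (- x) z = - rdot x z.
Proof. by rewrite /rdot dotNl ReN. Qed.
Lemma rdotNr x z : rdot z (- x) = - rdot z x.
Proof. by rewrite /rdot dotNr ReN. Qed.
Lemma rdotBl x y z : rdot (x - y) z = rdot x z - rdot y z.
Proof. by rewrite rdotDl rdotNl. Qed.
Lemma rdotBr x y z : rdot z (x - y) = rdot z x - rdot z y.
Proof. by rewrite rdotDr rdotNr. Qed.
Lemma rdotZl r x z : rdot (r%:C *: x) z = r * rdot x z.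
Proof. by rewrite /rdot dotZl ReM_real. Qed.
Lemma rdotZr r x z : rdot z (r%:C *: x) = r * rdot z x.
Proof. by rewrite rdotC rdotZl rdotC. Qed.

Lemma discriminant_le (a b c : R) : 0 <= a -> 0 <= c ->
  (forall t, 0 <= a + 2 * t * b + t ^+ 2 * c) -> b ^+ 2 <= a * c.
Proof.
move=> a0 c0 h; have [c1|c1] := ltrP 0 c.
  have := h (- b / c); rewrite -(pmulr_rge0 _ c1).
  rewrite (_ : c * _ = a * c - b ^+ 2); first by rewrite subr_ge0.
  by field; rewrite gt_eqF.
have c00 : c = 0 by apply/eqP; rewrite eq_le c1 c0.
rewrite c00 mulr0; have [->|b0] := eqVneq b 0; first by rewrite expr0n.
(* With [c = 0] and [b] nonzero the expression is affine in [t] and equals [-1] at this point. *)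
have := h (- (a + 1) / (2 * b)); rewrite c00 mulr0 addr0.
rewrite (_ : a + _ = -1); first by lra.
by field.
Qed.

Lemma rdot_cauchy x y : rdot x y <= rnorm x * rnorm y.
Proof.
have h : rdot x y ^+ 2 <= rnorm x ^+ 2 * rnorm y ^+ 2.
  apply: discriminant_le; rewrite ?sqr_ge0// => t.
  rewrite (_ : _ + _ = rnorm (x + t%:C *: y) ^+ 2) ?sqr_ge0//.
  rewrite -!rdot_self rdotDl !rdotDr rdotZl !rdotZr (rdotC y x) rdotZl; ring.
have [xy0|xy0] := lerP (rdot x y) 0.
  by apply: le_trans xy0 _; rewrite mulr_ge0 ?rnorm_ge0.
move: h; rewrite -exprMn ler_sqr ?nnegrE ?mulr_ge0 ?rnorm_ge0//; exact: ltW.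
Qed.

Lemma rdot_abs x y : `|rdot x y| <= rnorm x * rnorm y.
Proof.
rewrite ler_norml rdot_cauchy andbT -[rdot x y]opprK lerN2 -rdotNl.
by rewrite -(rnormN x); exact: rdot_cauchy.
Qed.

Lemma ler_rnormB x y : rnorm x - rnorm y <= rnorm (x - y).
Proof. by rewrite lerBlDr -{1}(subrK y x) ler_rnormD. Qed.

Lemma parallelogram x y :
  rnorm (x + y) ^+ 2 + rnorm (x - y) ^+ 2 = 2 * rnorm x ^+ 2 + 2 * rnorm y ^+ 2.
Proof.
rewrite -!rdot_self !(rdotDl, rdotDr, rdotNl, rdotNr).
by rewrite (rdotC y x); ring.
Qed.

Definition rcauchy (u : nat -> H) : Prop := forall e, 0 < e -> exists N,
  forall m n, (N <= m)%N -> (N <= n)%N -> rnorm (u m - u n) <= e.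

Definition rcvg (u : nat -> H) (y : H) : Prop := forall e, 0 < e -> exists N,
  forall n, (N <= n)%N -> rnorm (u n - y) <= e.

Lemma rcauchy_rcvg u : rcauchy u -> exists y, rcvg u y.
Proof.
move=> cu.
have cvu : cvg (u @ \oo).
  apply: cauchy_cvg; apply/cauchyP => e e0.
  have eR : e = (complex.Re e)%:C by apply/ge0_ReE/ltW.
  have e1 : 0 < complex.Re e by rewrite -ltcR -eR.
  have [|N hN] := cu (complex.Re e / 2); first by rewrite divr_gt0.
  exists (u N); exists N => // n /= Nn.
  rewrite -ball_normE /ball_ /= normr_rnorm eR ltcR.
  apply: le_lt_trans (hN N n _ _) _ => //.
  by rewrite ltr_pdivrMr// ltr_pMr// ltr1n.
exists (lim (u @ \oo)) => e e0.
have /cvgrPdist_le/(_ e%:C) : u @ \oo --> lim (u @ \oo) by [].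
rewrite ltcR => /(_ e0)[N _ hN]; exists N => n Nn.
by have := hN n Nn; rewrite /= normr_rnorm lecR rnormBC.
Qed.

Definition rbounded (A : H -> H) : Prop :=
  exists2 C, 0 <= C & forall x, rnorm (A x) <= C * rnorm x.

Lemma continuous_rbounded (A : H -> H) : linear A -> continuous A -> rbounded A.
Proof.
move=> lA cA; have /cvgrPdist_le/(_ 1 ltr01) := cA 0.
rewrite (lin_zero lA) => /nbhs_ballP[d /= d0 hd].
have dR : d = (complex.Re d)%:C by apply/ge0_ReE/ltW.
have d1 : 0 < complex.Re d by rewrite -ltcR -dR.
set r := complex.Re d in dR d1.
exists (2 / r) => [|x]; first by rewrite divr_ge0// ltW.
have [->|/eqP x0] := eqVneq x 0; first by rewrite (lin_zero lA) rnorm0 mulr0.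
have nx := rnorm_gt0 x0.
have := hd ((r / (2 * rnorm x))%:C *: x).
rewrite -ball_normE /ball_ /= !sub0r !normrN !normr_rnorm (lin_scale lA).
have r2 : 0 < r / (2 * rnorm x) by rewrite divr_gt0 ?mulr_gt0.
rewrite !rnorm_realZ !gtr0_norm// dR ltcR lecR => h.
have {}h : r / (2 * rnorm x) * rnorm (A x) <= 1.
  apply: h; rewrite (_ : r / (2 * rnorm x) * rnorm x = r / 2); first by rewrite ltr_pdivrMr// ltr_pMr// ltr1n.
  by field; rewrite gt_eqF.
rewrite -(ler_pM2l r2); apply: le_trans h _.
rewrite (_ : _ * _ = 1) //; by field; rewrite !gt_eqF.
Qed.

Lemma rbounded_continuous (A : H -> H) : linear A -> rbounded A -> continuous A.
Proof.
move=> lA [C C0 hC] x; apply/cvgrPdist_le => e e0.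
have eR : e = (complex.Re e)%:C by apply/ge0_ReE/ltW.
have e1 : 0 < complex.Re e by rewrite -ltcR -eR.
set r := complex.Re e in eR e1.
have C1 : 0 < C + 1 by rewrite ltr_wpDl.
apply/nbhs_ballP; exists (r / (C + 1))%:C => /=; first by rewrite ltcR divr_gt0.
move=> y; rewrite -ball_normE /ball_ /= -(lin_sub lA) !normr_rnorm eR ltcR lecR.
rewrite ltr_pdivlMr// => h; apply: le_trans (hC _) _.
by have := rnorm_ge0 (x - y); nra.
Qed.

Lemma rcvg_unique u y z : rcvg u y -> rcvg u z -> y = z.
Proof.
move=> uy uz; apply/eqP; rewrite -subr_eq0; apply/eqP/rnorm_eq0.
apply/eqP; rewrite eq_le rnorm_ge0 andbT; apply/ler_addgt0Pl => e e0.
rewrite addr0; have e2 : 0 < e / 2 by rewrite divr_gt0.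
have [N hN] := uy _ e2; have [M hM] := uz _ e2.
have := hN (N + M)%N (leq_addr _ _); have := hM (N + M)%N (leq_addl _ _).
rewrite (_ : y - z = (u (N + M)%N - z) - (u (N + M)%N - y)); last first.
  by rewrite opprB [RHS]addrC addrA subrK.
have := ler_rnormD (u (N + M)%N - z) (- (u (N + M)%N - y)); rewrite rnormN; lra.
Qed.

Lemma rcvg_rnorm_le u y (C : R) : rcvg u y -> (forall n, rnorm (u n) <= C) ->
  rnorm y <= C.
Proof.
move=> uy uC; apply/ler_addgt0Pr => e e0; have [N hN] := uy e e0.
have := ler_rnormB y (u N); have := hN N (leqnn _); rewrite rnormBC.
have := uC N; lra.
Qed.

Lemma rcvg_image (A : H -> H) u y : linear A -> rbounded A -> rcvg u y ->
  rcvg (A \o u) (A y).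
Proof.
move=> lA [C C0 hC] uy e e0.
have C1 : 0 < C + 1 by rewrite ltr_wpDl.
have [|N hN] := uy (e / (C + 1)); first by rewrite divr_gt0.
exists N => n /hN; rewrite /= -(lin_sub lA) ler_pdivlMr// => h.
by apply: le_trans (hC _) _; have := rnorm_ge0 (u n - y); nra.
Qed.

Lemma rcvgD u v y z : rcvg u y -> rcvg v z -> rcvg (fun n => u n + v n) (y + z).
Proof.
move=> uy vz e e0; have e2 : 0 < e / 2 by rewrite divr_gt0.
have [N hN] := uy _ e2; have [M hM] := vz _ e2; exists (maxn N M) => n.
rewrite geq_max => /andP[/hN h1 /hM h2]; rewrite opprD addrACA.
by apply: le_trans (ler_rnormD _ _) _; lra.
Qed.

Lemma rnormZ (a : R[i]) x : rnorm (a *: x) = complex.Re `|a| * rnorm x.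
Proof. by rewrite /rnorm normrZ (ge0_ReE (normr_ge0 a)) ReM_real. Qed.

Lemma rcvgZ u y (a : R[i]) : rcvg u y -> rcvg (fun n => a *: u n) (a *: y).
Proof.
apply: (@rcvg_image (fun x => a *: x)).
  by move=> b x z; rewrite scalerDr !scalerA mulrC.
exists (complex.Re `|a|) => [|x]; last by rewrite rnormZ.
by have := normr_ge0 a; rewrite {1}(ge0_ReE (normr_ge0 a)) lecR.
Qed.

Lemma rcvg_rdot u y z (C : R) : rcvg u y -> (forall n, rdot (u n) z <= C) ->
  rdot y z <= C.
Proof.
move=> uy uC; apply/ler_addgt0Pr => e e0.
have z1 : 0 < rnorm z + 1 by rewrite ltr_wpDl ?rnorm_ge0.
have [|N hN] := uy (e / (rnorm z + 1)); first by rewrite divr_gt0.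
have := hN N (leqnn _); rewrite ler_pdivlMr// => h.
have := rdot_cauchy (y - u N) z; rewrite rnormBC rdotBl.
have := uC N; have := rnorm_ge0 (u N - y); nra.
Qed.

(** The scalars [1] and [-i] read off the real and the imaginary part. *)
Lemma rdot_ext x y x' y' :
  (forall a : R[i], rdot (a *: x) y = rdot (a *: x') y') -> dot x y = dot x' y'.
Proof.
move=> h; have := h 1; have := h (- 'i)%C; rewrite /rdot !dotZl !mul1r.
case: (dot x y) (dot x' y') => [a b] [c d] /=.
by rewrite !oppr0 !mul0r !sub0r !mulN1r !opprK => -> ->.
Qed.

Lemma rcvg_dot_eq0 u y z : rcvg u y -> (forall n, dot (u n) z = 0) -> dot y z = 0.
Proof.
move=> uy uz; rewrite -(dot0l z); apply: rdot_ext => a.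
have r0 n : rdot (a *: u n) z = 0 by rewrite /rdot dotZl uz mulr0.
rewrite scaler0 {2}/rdot dot0l /=; apply/eqP; rewrite eq_le; apply/andP; split.
  by apply: rcvg_rdot (rcvgZ a uy) _ => n; rewrite r0.
rewrite -oppr_le0 -rdotNl -scaleNr.
by apply: rcvg_rdot (rcvgZ (- a) uy) _ => n; rewrite scaleNr rdotNl r0 oppr0.
Qed.

Lemma dot_rdot_selfadjoint (A : H -> H) : linear A ->
  (forall x y, rdot (A x) y = rdot x (A y)) -> selfadjoint dot A.
Proof.
move=> lA sA x y; apply: rdot_ext => a.
by rewrite -(lin_scale lA) sA.
Qed.

Lemma selfadjoint_rdot (A : H -> H) : selfadjoint dot A ->
  forall x y, rdot (A x) y = rdot x (A y).
Proof. by move=> sA x y; rewrite /rdot sA. Qed.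

End RealInnerProduct.

(** * Compactness by sequences and the largest eigenvalue *)

Section CompactSelfadjoint.
Context {R : realType} {H : completeNormedModType R[i]}.
Variables (dot : {dot H for conjC}) (hdot : hilbert_inner dot).
Local Notation rdot := (rdot dot).
Implicit Types (x y z : H) (r : R) (A : H -> H).

Definition seq_compact A : Prop := forall u : nat -> H,
  (forall n, rnorm (u n) <= 1) ->
  exists2 phi : nat -> nat,
    (forall k, (phi k < phi k.+1)%N) & rcauchy (A \o u \o phi).

Lemma subseq_ge (phi : nat -> nat) : (forall k, (phi k < phi k.+1)%N) ->
  forall k, (k <= phi k)%N.
Proof. by move=> h; elim=> [|k IH] //; apply: leq_ltn_trans IH (h k). Qed.

Lemma rcvg_rcauchy (u : nat -> H) y : rcvg u y -> rcauchy u.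
Proof.
move=> uy e e0; have [|N hN] := uy (e / 2); first by rewrite divr_gt0.
exists N => m n /hN h1 /hN; rewrite rnormBC => h2.
rewrite (_ : u m - u n = (u m - y) + (y - u n)); last by rewrite addrA subrK.
by apply: le_trans (ler_rnormD _ _) _; lra.
Qed.

Lemma cluster_subseq (v : nat -> H) y :
  (forall e N, 0 < e -> exists2 n, (N <= n)%N & rnorm (v n - y) <= e) ->
  exists2 phi : nat -> nat, (forall k, (phi k < phi k.+1)%N) & rcvg (v \o phi) y.
Proof.
move=> vy.
have /choice[f hf] : forall p : nat * nat, exists n, (p.1 <= n)%N /\
    rnorm (v n - y) <= p.2.+1%:R^-1.
  by move=> [N k] /=; have [//|n] := vy k.+1%:R^-1 N; exists n.
pose phi := fix F k := if k is k'.+1 then f ((F k').+1, k'.+1) else f (0%N, 0%N).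
exists phi => [k|e e0]; first exact: (hf (_, _)).1.
exists (Num.truncn e^-1) => n hn.
have h : rnorm (v (phi n) - y) <= n.+1%:R^-1.
  by case: n {hn} => [|n]; apply: (hf (_, _)).2.
apply: le_trans h _; rewrite -[e]invrK lef_pV2 ?posrE ?invr_gt0//.
apply: le_trans (ltW (truncnS_gt _)) _; by rewrite ler_nat.
Qed.

Lemma compact_seq_compact A : compact_operator A -> seq_compact A.
Proof.
move=> [lA]; rewrite precompactE => cA u u1.
have [|y [_ ycl]] := cA ((A \o u) @ \oo) _.
  exists 0%N => // n _; apply: subset_closure; exists (u n) => //=.
  by rewrite normr_rnorm -(@rmorph1 _ _ (real_complex R)) lecR.
have [|phi mphi cphi] := @cluster_subseq (A \o u) y.
  move=> e N e0.
  have hF : ((A \o u) @ \oo) [set A (u n) | n in [set n | (N <= n)%N]].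
    by exists N => // n Nn; exists n.
  have hB : nbhs y (ball y e%:C) by apply: nbhsx_ballx; rewrite ltcR.
  have [z [[n Nn <-]]] := ycl _ _ hF hB.
  rewrite -ball_normE /ball_ /= normr_rnorm ltcR => /ltW h.
  by exists n; rewrite // rnormBC.
by exists phi => //; apply: rcvg_rcauchy cphi.
Qed.

(* Only the pseudometric [|A x - A y|] matters, so compactness passes to the
   square and to the absolute value. *)
Lemma seq_compact_dominated A (B : H -> H) (C : R) : 0 <= C ->
  (forall x y, rnorm (B x - B y) <= C * rnorm (A x - A y)) ->
  seq_compact A -> seq_compact B.
Proof.
move=> C0 BA cA u /cA[phi mphi cu]; exists phi => // e e0.
have C1 : 0 < C + 1 by rewrite ltr_wpDl.
have [|N hN] := cu (e / (C + 1)); first by rewrite divr_gt0.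
exists N => m n Nm Nn; have := hN m n Nm Nn; rewrite ler_pdivlMr //= => h.
apply: le_trans (BA _ _) _.
by have := rnorm_ge0 (A (u (phi m)) - A (u (phi n))); nra.
Qed.

Lemma unit_vector x : x <> 0 -> rnorm ((rnorm x)^-1%:C *: x) = 1.
Proof.
move=> /rnorm_gt0 x0; rewrite rnorm_realZ gtr0_norm ?invr_gt0//.
by rewrite mulVf// gt_eqF.
Qed.

(** Unit vectors [u n] with [|A (u n)| >= n] would leave no bounded, hence no Cauchy, subsequence of
    images. *)
Lemma seq_compact_rbounded A : linear A -> seq_compact A -> rbounded A.
Proof.
move=> lA cA; apply: contrapT => nb.
have /choice[u hu] : forall n : nat, exists x, rnorm x = 1 /\ n%:R <= rnorm (A x).
  move=> n; apply: contrapT => nx; apply: nb; exists n%:R => // x.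
  have [->|/eqP x0] := eqVneq x 0; first by rewrite (lin_zero lA) rnorm0 mulr0.
  rewrite leNgt; apply/negP => hx; apply: nx.
  exists ((rnorm x)^-1%:C *: x); split; first exact: unit_vector.
  have n0 := rnorm_gt0 x0.
  rewrite (lin_scale lA) rnorm_realZ gtr0_norm ?invr_gt0//.
  by rewrite mulrC ler_pdivlMr// ltW.
have [|phi mphi /(_ 1 ltr01)[N hN]] := cA u.
  by move=> n; rewrite (hu n).1.
set v := A \o u \o phi in hN.
pose m := (N + (Num.truncn (rnorm (v N) + 1)).+1)%N.
have := hN m N (leq_addr _ _) (leqnn _).
have := ler_rnormB (v m) (v N); have := (hu (phi m)).2.
have mm : m%:R <= (phi m)%:R :> R by rewrite ler_nat subseq_ge.
have : rnorm (v N) + 1 < m%:R.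
  by apply: lt_le_trans (truncnS_gt _) _; rewrite ler_nat leq_addl.
rewrite /v /=; lra.
Qed.

(** Meant for the orthogonal complement of finitely many eigenvectors, where the search for the next
    one takes place. *)
Definition closed_invariant A (M : set H) : Prop :=
  [/\ forall x y, M x -> M y -> M (x + y),
      forall (a : R[i]) x, M x -> M (a *: x),
      forall x, M x -> M (A x) &
      forall u y, (forall n, M (u n)) -> rcvg u y -> M y].

Section MaximalEigenvalue.
Variables (A : H -> H) (M : set H).
Hypotheses (lA : linear A) (cA : seq_compact A) (sA : selfadjoint dot A).
Hypothesis hM : closed_invariant A M.

Lemma form_unit_bound (m : R) : (forall x, M x -> rnorm x <= 1 -> rdot (A x) x <= m) ->
  forall x, M x -> rdot (A x) x <= m * rnorm x ^+ 2.
Proof.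
move=> h x Mx; have [_ MZ _ _] := hM.
have [->|/eqP x0] := eqVneq x 0.
  by rewrite (lin_zero lA) /rdot dot0l rnorm0 expr0n mulr0.
have n0 := rnorm_gt0 x0.
have := h _ (MZ (rnorm x)^-1%:C _ Mx); rewrite (unit_vector x0) => /(_ (lexx _)).
rewrite (lin_scale lA) rdotZl rdotZr mulrA -invfM.
by rewrite mulrC ler_pdivrMr ?mulr_gt0// expr2.
Qed.

(* Cauchy-Schwarz for the nonnegative form [m <x, y> - <A x, y>] on [M]. *)
Lemma residual_bound (m C : R) : 0 <= m -> 0 <= C ->
  (forall x, rnorm (A x) <= C * rnorm x) ->
  (forall x, M x -> rdot (A x) x <= m * rnorm x ^+ 2) ->
  forall x, M x -> rnorm (m%:C *: x - A x) ^+ 2 <=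
    (m + C) * (m * rnorm x ^+ 2 - rdot (A x) x).
Proof.
move=> m0 C0 hC hm x Mx; have [MD MZ MA _] := hM.
pose q y := m * rnorm y ^+ 2 - rdot (A y) y.
have q0 y : M y -> 0 <= q y by move=> /hm; rewrite subr_ge0.
have sAr : forall x y, rdot (A x) y = rdot x (A y) by apply: selfadjoint_rdot.
have qD t w : q (x + t%:C *: w) =
    q x + 2 * t * (m * rdot x w - rdot (A x) w) + t ^+ 2 * q w.
  rewrite /q -!(rdot_self hdot) (lin_add lA) (lin_scale lA).
  rewrite !(rdotDl, rdotDr, rdotZl, rdotZr) (rdotC dot w x).
  by rewrite (sAr w x) (rdotC dot w (A x)); ring.
set z := m%:C *: x - A x.
have Mz : M z by apply: MD; [exact: MZ|rewrite -scaleN1r; apply: MZ; exact: MA].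
(* The form paired at [x] and [z] is [<m x - A x, z> = |z|^2], because [z] is the residual
   itself. *)
have CS : (rnorm z ^+ 2) ^+ 2 <= q x * q z.
  apply: discriminant_le => [||t]; [exact: q0|exact: q0|].
  have -> : rnorm z ^+ 2 = m * rdot x z - rdot (A x) z.
    by rewrite -(rdot_self hdot) {1}/z rdotBl rdotZl.
  by rewrite -qD; apply: q0; apply: MD => //; apply: MZ.
have qz : q z <= (m + C) * rnorm z ^+ 2.
  have := rdot_abs hdot (A z) z; rewrite ler_norml => /andP[h _].
  have := hC z; have := rnorm_ge0 z; rewrite /q; nra.
have [z0|z0] := eqVneq (rnorm z ^+ 2) 0.
  by rewrite z0; apply: mulr_ge0 (q0 x Mx); rewrite addr_ge0.
have zp : 0 < rnorm z ^+ 2 by rewrite lt_def z0 sqr_ge0.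
rewrite -/(q x) -(ler_pM2r zp) -expr2; apply: le_trans CS _.
rewrite mulrAC [leRHS]mulrC.
by apply: ler_wpM2l => //; exact: q0.
Qed.

(** Along a maximising sequence the residual [m u - A u] tends to 0 by [residual_bound]. On a
    subsequence [A u] converges, hence so does [u] because [m > 0], and the limit is an eigenvector
    for the supremum [m]. *)
Lemma max_eigenpair : (exists2 x, M x & 0 < rdot (A x) x) ->
  exists (m : R) e, [/\ 0 < m, M e, rnorm e = 1, A e = m%:C *: e &
    forall x, M x -> rdot (A x) x <= m * rnorm x ^+ 2].
Proof.
move=> [x0 Mx0 px0]; have [MD MZ MA Mcl] := hM.
have [C C0 hC] := seq_compact_rbounded lA cA.
pose S := [set rdot (A x) x | x in [set x | M x /\ rnorm x <= 1]].
have Sub : has_ubound S.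
  exists C => _ [x [Mx x1] <-]; apply: le_trans (rdot_cauchy hdot _ _) _.
  have := hC x; have := rnorm_ge0 x; have := rnorm_ge0 (A x); nra.
have x00 : x0 <> 0.
  by move=> h; move: px0; rewrite h (lin_zero lA) /rdot dot0l ltxx.
have Sx0 : S ((rnorm x0)^-1 * ((rnorm x0)^-1 * rdot (A x0) x0)).
  exists ((rnorm x0)^-1%:C *: x0); last by rewrite (lin_scale lA) rdotZl rdotZr.
  by split; [exact: MZ|rewrite unit_vector].
have Ssup : has_sup S by split=> //; exists ((rnorm x0)^-1 * ((rnorm x0)^-1 * rdot (A x0) x0)).
pose m := sup S.
have m0 : 0 < m.
  apply: lt_le_trans (ub_le_sup Sub Sx0).
  by rewrite !mulr_gt0// invr_gt0 rnorm_gt0.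
have hm : forall x, M x -> rdot (A x) x <= m * rnorm x ^+ 2.
  apply: form_unit_bound => x Mx x1; apply: ub_le_sup => //; by exists x.
have /choice[u hu] : forall n : nat, exists x, [/\ M x, rnorm x <= 1 &
    m - n.+1%:R^-1 < rdot (A x) x].
  move=> n; have n0 : 0 < n.+1%:R^-1 :> R by [].
  by have [_ [x [Mx x1] <-] h] := sup_adherent n0 Ssup; exists x.
have [|phi mphi /rcauchy_rcvg[y Ay]] := cA (u := u).
  by move=> n; have [] := hu n.
have D0 : 0 < m + C by rewrite ltr_pwDl.
have zto0 : rcvg (fun n => m%:C *: u (phi n) - A (u (phi n))) 0.
  move=> e e0.
  exists (Num.truncn ((m + C) / e ^+ 2)) => n hn; rewrite subr0.
  have [Mu u1 hlow] := hu (phi n).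
  have := residual_bound (ltW m0) C0 hC hm Mu.
  set w := m%:C *: _ - _ => h.
  rewrite -ler_sqr ?nnegrE ?rnorm_ge0 ?(ltW e0)//; apply: le_trans h _.
  have : (m + C) / e ^+ 2 < (phi n).+1%:R.
    apply: lt_le_trans (truncnS_gt _) _; rewrite ler_nat ltnS.
    by apply: leq_trans hn _; exact: subseq_ge.
  rewrite ltr_pdivrMr ?exprn_gt0// => h2.
  apply: le_trans (_ : (m + C) * (phi n).+1%:R^-1 <= _).
    rewrite ler_pM2l//.
    have u2 : rnorm (u (phi n)) ^+ 2 <= 1.
      by rewrite expr_le1// rnorm_ge0.
    have h3 := ler_wpM2l (ltW m0) u2; rewrite mulr1 in h3.
    by rewrite lerBlDr; apply: le_trans h3 _; rewrite -lerBlDl ltW.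
  by rewrite ler_pdivrMr// mulrC ltW.
have mu : rcvg (fun n => u (phi n)) (m^-1%:C *: y).
  have := rcvgZ m^-1%:C (rcvgD zto0 Ay); rewrite add0r.
  congr (rcvg _ _); apply/funext => n /=; rewrite subrK scalerA -rmorphM /=.
  by rewrite mulVf ?gt_eqF// scale1r.
set x := m^-1%:C *: y in mu.
have Mx : M x by apply: Mcl mu => n; have [] := hu (phi n).
have yE : y = m%:C *: x by rewrite scalerA -rmorphM /= mulfV ?gt_eqF// scale1r.
have Ax : A x = m%:C *: x.
  rewrite -yE; apply: rcvg_unique Ay; apply: rcvg_image mu => //.
  by exists C.
(* If the limit were 0, then eventually [|A u| <= m/3], whereas [<A u, u> > m - m/3] and
   [|u| <= 1]. *)
have xn0 : x <> 0.
  move=> x0'; rewrite yE x0' scaler0 in Ay.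
  have m2 : 0 < m / 3 by rewrite divr_gt0.
  have [N hN] := Ay _ m2.
  pose n := (N + (Num.truncn (3 / m)))%N.
  have [_ u1 hlow] := hu (phi n).
  have := hN n (leq_addr _ _); rewrite subr0 /= => h1.
  have h2 : (phi n).+1%:R^-1 <= m / 3.
    rewrite -[m / 3]invrK lef_pV2 ?posrE ?invr_gt0// invf_div.
    apply: le_trans (ltW (truncnS_gt _)) _; rewrite ler_nat ltnS.
    by apply: leq_trans (subseq_ge mphi n); exact: leq_addl.
  have := rdot_cauchy hdot (A (u (phi n))) (u (phi n)).
  have : rnorm (A (u (phi n))) * rnorm (u (phi n)) <= rnorm (A (u (phi n))).
    by rewrite ler_piMr ?rnorm_ge0.
  by move: hlow h2; move: (_ ^-1) => i; lra.
exists m, ((rnorm x)^-1%:C *: x); split=> //; first exact: MZ.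
  exact: unit_vector.
by rewrite (lin_scale lA) Ax [LHS]scalerA [RHS]scalerA mulrC.
Qed.

End MaximalEigenvalue.
End CompactSelfadjoint.

(** * Dimension counting and uniqueness of the eigenvalue sequence *)

Section Dimension.
Context {R : realType} {H : completeNormedModType R[i]}.
Variable (dot : {dot H for conjC}).

Lemma wide_kernel (K : fieldType) (m n : nat) (B : 'M[K]_(m, n)) : (n < m)%N ->
  exists2 c : 'rV[K]_m, c != 0 & c *m B = 0.
Proof.
move=> nm; have : kermx B != 0.
  by rewrite -mxrank_eq0 mxrank_ker subn_eq0 -ltnNge (leq_ltn_trans (rank_leq_col B)).
by move=> /rowV0Pn[c /sub_kermxP cB c0]; exists c.
Qed.

(** All the eigenvalue inequalities rest on this count: [size w] linear conditions on more than
    [size w] coefficients. Only the coefficients are nontrivial here; for orthonormal [v],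
    [ortho_neq0] makes the vector nonzero. *)
Lemma orthogonal_combination (n : nat) (v : 'I_n -> H) (w : seq H) :
  (size w < n)%N ->
  exists c : 'I_n -> R[i], (exists i, c i != 0) /\
    forall f, f \in w -> dot (\sum_i c i *: v i) f = 0.
Proof.
move=> wn.
have [c c0 cB] := wide_kernel (\matrix_(i < n, j < size w) dot (v i) w`_j) wn.
exists (c 0); split.
  by have /rV0Pn[i ci] := c0; exists i.
move=> f /(nthP 0)[j jw <-].
have /matrixP/(_ 0 (Ordinal jw)) := cB; rewrite !mxE => h.
rewrite -[RHS]h dot_suml; by apply: eq_bigr => i _; rewrite dotZl mxE.
Qed.

Lemma has_dim_leq (V : set H) d d' : has_dim V d -> has_dim V d' -> (d' <= d)%N.
Proof.
move=> [e [_ _ eV]] [e' [Ve' fe' _]]; rewrite leqNgt; apply/negP => dd'.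
have /choice[M hM] : forall i, exists c : 'I_d -> R[i], e' i = \sum_j c j *: e j.
  by move=> i; apply: eV.
have [c c0 cB] := wide_kernel (\matrix_(i < d', j < d) M i j) dd'.
have /rV0Pn[i /eqP] := c0; apply; apply: (fe' (c 0)).
under eq_bigr => k _ do rewrite hM scaler_sumr.
rewrite exchange_big /=; apply: big1 => j _.
under eq_bigr => k _ do rewrite scalerA.
rewrite -scaler_suml; have /matrixP/(_ 0 j) := cB; rewrite !mxE => h.
have -> : \sum_k c 0 k * M k j = 0.
  by rewrite -[RHS]h; apply: eq_bigr => k _; rewrite mxE.
by rewrite scale0r.
Qed.

Lemma has_dim_unique (V : set H) d d' : has_dim V d -> has_dim V d' -> d = d'.
Proof.
by move=> h h'; apply/eqP; rewrite eqn_leq (has_dim_leq h' h) (has_dim_leq h h').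
Qed.

(** Suppose [l n < t = l' n] after a common beginning. By monotonicity [l] takes the value [t] only
    before [n], where [l'] agrees with it, while [l'] takes it once more at [n]. Yet both take it
    exactly dim ker [(A - t)] times. *)
Lemma pos_eigenvalue_seq_le (A : H -> H) l l' :
  is_pos_eigenvalue_seq A l -> is_pos_eigenvalue_seq A l' ->
  forall n, (forall i, (i < n)%N -> l i = l' i) -> l' n <= l n.
Proof.
move=> [lmono l0 lA] [l'mono l'0 l'A] n IH; rewrite leNgt; apply/negP => lt.
have t0 : 0 < l' n by apply: le_lt_trans lt; exact: l0.
have [d [hd cd]] := lA _ t0; have [d' [hd' cd']] := l'A _ t0.
have dd := has_dim_unique hd hd'; subst d'.
have lsub : [set i | l i = l' n] `<=` `I_n.
  move=> i /= li; rewrite ltnNge; apply/negP => /lmono.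
  by rewrite li leNgt lt.
have fl : finite_set [set i | l i = l' n] by apply: sub_finite_set lsub (finite_II n).
have fl' : finite_set [set i | l' i = l' n] by apply/finite_setP; exists d.
have := card_eq_trans cd (etrans (card_eq_sym _ _) cd').
move=> /(fcard_eq fl fl') cE.
have : (fset_set [set i | l i = l' n] `<` fset_set [set i | l' i = l' n])%fset.
  rewrite fproperE; apply/andP; split.
    apply/fsubsetP => i; rewrite !in_fset_set// !inE /= => li.
    by rewrite -(IH i (lsub _ li)).
  apply/fsubsetPn; exists n; rewrite in_fset_set// ?inE//=.
  by apply/negP; rewrite inE /= => li; move: lt; rewrite li ltxx.
by move=> /fproper_ltn_card; rewrite cE ltnn.
Qed.

Lemma pos_eigenvalue_seq_unique (A : H -> H) l l' :
  is_pos_eigenvalue_seq A l -> is_pos_eigenvalue_seq A l' -> l = l'.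
Proof.
move=> hl hl'; apply/funext => n; elim/ltn_ind: n => n IH.
apply/eqP; rewrite eq_le (pos_eigenvalue_seq_le hl hl')// andbT.
by apply: (pos_eigenvalue_seq_le hl' hl) => i /IH.
Qed.

Lemma lambda_plusE (A : H -> H) l : is_pos_eigenvalue_seq A l -> lambda_plus A = l.
Proof.
move=> hl; apply: (@pos_eigenvalue_seq_unique A) => //.
exact: (getPex (P := [set l | is_pos_eigenvalue_seq A l])) (ex_intro _ l hl).
Qed.

End Dimension.

(** * Greedy construction of eigenvectors and its completeness *)

Section EigenSystem.
Context {R : realType} {H : completeNormedModType R[i]}.
Variables (dot : {dot H for conjC}) (hdot : hilbert_inner dot).
Local Notation rdot := (rdot dot).

(* Once the positive eigenvalues are exhausted, [l n = 0] and [e n = 0]. *)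
Record eigen_system (A : H -> H) (l : nat -> R) (e : nat -> H) : Prop := EigenSystem {
  es_ge0 : forall n, 0 <= l n;
  es_eigen : forall n, A (e n) = (l n)%:C *: e n;
  es_unit : forall n, 0 < l n -> rnorm (e n) = 1;
  es_null : forall n, l n = 0 -> e n = 0;
  es_ortho : forall i j, i != j -> dot (e i) (e j) = 0;
  es_max : forall n x, (forall i, (i < n)%N -> dot x (e i) = 0) ->
    rdot (A x) x <= l n * rnorm x ^+ 2 }.

Section Construction.
Variable A : H -> H.
Hypotheses (lA : linear A) (cA : seq_compact A) (sA : selfadjoint dot A).

Definition orth (s : seq H) : set H := [set x | forall f, f \in s -> dot x f = 0].

Definition eigenvectors (s : seq H) : Prop :=
  forall f, f \in s -> exists r : R, A f = r%:C *: f.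

Lemma orth_closed_invariant s : eigenvectors s -> closed_invariant A (orth s).
Proof.
move=> es; split.
- by move=> x y Mx My f fs; rewrite dotDl Mx// My// addr0.
- by move=> a x Mx f fs; rewrite dotZl Mx// mulr0.
- by move=> x Mx f fs; have [r Af] := es f fs; rewrite sA Af dotZr Mx// mulr0.
- by move=> u y Mu uy f fs; apply: (rcvg_dot_eq0 hdot uy) => n; apply: Mu.
Qed.

Lemma next_eigenpair s : exists p : R * H, eigenvectors s ->
  [/\ 0 <= p.1, A p.2 = p.1%:C *: p.2, 0 < p.1 -> rnorm p.2 = 1,
      p.1 = 0 -> p.2 = 0 &
      orth s p.2 /\ forall x, orth s x -> rdot (A x) x <= p.1 * rnorm x ^+ 2].
Proof.
have [es|?] := pselect (eigenvectors s); last by exists (0, 0).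
have [ex|nex] := pselect (exists2 x, orth s x & 0 < rdot (A x) x).
  have [m [e [m0 Me e1 Ae hm]]] :=
    max_eigenpair hdot lA cA sA (orth_closed_invariant es) ex.
  by exists (m, e) => _; split=> //=; [exact: ltW|move=> m00; rewrite m00 ltxx in m0].
exists (0, 0) => _; split=> //=; rewrite ?(lin_zero lA) ?scaler0 ?ltxx//.
split=> [f _|x Mx]; first by rewrite dot0l.
by rewrite mul0r leNgt; apply/negP => px; apply: nex; exists x.
Qed.

Lemma eigen_system_exists : exists l e, eigen_system A l e.
Proof.
have [nxt hnxt] := choice next_eigenpair.
pose st := fix st n := if n is n'.+1 then rcons (st n') (nxt (st n')).2 else [::].
pose l n := (nxt (st n)).1; pose e n := (nxt (st n)).2.
have est n : eigenvectors (st n).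
  elim: n => [|n IH] f //=; rewrite mem_rcons inE => /orP[/eqP ->|/IH//].
  by have [_ h _ _ _] := hnxt _ IH; exists (l n).
have ste n f : f \in st n -> exists2 i, (i < n)%N & f = e i.
  elim: n => [|n IH] //=; rewrite mem_rcons inE => /orP[/eqP ->|/IH[i ni ->]].
    by exists n.
  by exists i => //; apply: ltnW.
have est' i n : (i < n)%N -> e i \in st n.
  elim: n => [|n IH] //=; rewrite ltnS leq_eqVlt mem_rcons inE.
  by case/orP=> [/eqP ->|/IH ->]; rewrite ?eqxx ?orbT.
have lt_ortho i j : (i < j)%N -> dot (e j) (e i) = 0.
  by move=> ij; have [_ _ _ _ [h _]] := hnxt _ (est j); apply: h; apply: est'.
exists l, e; split.
- by move=> n; have [] := hnxt _ (est n).
- by move=> n; have [] := hnxt _ (est n).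
- by move=> n; have [] := hnxt _ (est n).
- by move=> n; have [] := hnxt _ (est n).
- move=> i j; rewrite neq_ltn => /orP[ij|ji]; last exact: lt_ortho.
  exact/dot_sym0/lt_ortho.
- move=> n x hx; have [_ _ _ _ [_ h]] := hnxt _ (est n).
  by apply: h => f /ste[i ni ->]; apply: hx.
Qed.

End Construction.

Section Properties.
Variables (A : H -> H) (l : nat -> R) (e : nat -> H).
Hypotheses (lA : linear A) (sA : selfadjoint dot A) (es : eigen_system A l e).

(** The vector [e n] competes in the maximum at stage [m], being orthogonal to all earlier
    vectors. *)
Lemma es_mono m n : (m <= n)%N -> l n <= l m.
Proof.
move=> mn; have := es_ge0 es n; rewrite le_eqVlt => /orP[/eqP <-|ln].
  exact: (es_ge0 es).
have := @es_max _ _ _ es m (e n); rewrite (es_eigen es) rdotZl (rdot_self hdot).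
rewrite (es_unit es ln) expr1n !mulr1; apply=> i im; apply: (es_ortho es).
by rewrite gtn_eqF// (leq_trans im).
Qed.

Lemma es_dot i j : 0 < l i -> dot (e i) (e j) = (i == j)%:R.
Proof.
move=> li; case: eqVneq => [<-|ij]; last exact: (es_ortho es).
by rewrite (dot_self hdot) (es_unit es li) expr1n.
Qed.

(** Otherwise the vectors [A (e n)] are orthogonal of length at least [r], so any two are more than
    [r] apart. *)
Lemma es_cvg0 (cA : seq_compact A) r : 0 < r -> exists N, l N < r.
Proof.
move=> r0; apply: contrapT => nex.
have lr n : r <= l n by rewrite leNgt; apply/negP => h; apply: nex; exists n.
have l0 n : 0 < l n by apply: lt_le_trans (lr n).
have [|phi mphi /(_ r r0)[N hN]] := cA e.
  by move=> n; rewrite (es_unit es).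
have := hN N N.+1 (leqnn _) (leqnSn _); rewrite /= !(es_eigen es).
rewrite -ler_sqr ?nnegrE ?rnorm_ge0 ?(ltW r0)// -(rdot_self hdot).
have h0 : rdot (e (phi N)) (e (phi N.+1)) = 0.
  by rewrite /rdot es_dot// ltn_eqF// mphi.
rewrite !(rdotDl, rdotDr, rdotNl, rdotNr, rdotZl, rdotZr) !(rdot_self hdot).
rewrite (rdotC dot (e (phi N.+1))) h0 !(es_unit es)//.
by have := lr (phi N); have := lr (phi N.+1); nra.
Qed.

Lemma eigen_ortho (a b : R) x y : A x = a%:C *: x -> A y = b%:C *: y -> a != b ->
  dot x y = 0.
Proof.
move=> Ax Ay ab; have := sA x y; rewrite Ax Ay dotZl dotZr.
have -> : conjC b%:C = b%:C by rewrite conjC_conjc /= oppr0.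
move=> /eqP; rewrite -subr_eq0 -mulrBl mulf_eq0 => /orP[|/eqP//].
by rewrite subr_eq0 => /eqP[] /eqP; rewrite (negbTE ab).
Qed.

(** Completeness: an eigenvector for [t], minus its projection on the [e n] with [l n = t], is
    orthogonal to every [e n], the others having different eigenvalues. Maximality at an [N] with
    [l N < t] then makes the remainder vanish. *)
Lemma es_pos_eigenvalue_seq (cA : seq_compact A) : is_pos_eigenvalue_seq A l.
Proof.
split; [exact: es_mono|exact: (es_ge0 es)|move=> t t0].
have [N lN] := es_cvg0 cA t0.
pose s := [seq n <- iota 0 N | l n == t].
have us : uniq s by rewrite filter_uniq ?iota_uniq.
have sP n : (n \in s) = (l n == t).
  rewrite mem_filter mem_iota add0n; case: eqVneq => //= lnt.
  by rewrite ltnNge; apply/negP => /es_mono; rewrite lnt leNgt lN.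
have ls (i : 'I_(size s)) : l (nth 0%N s i) = t by apply/eqP; rewrite -sP mem_nth.
exists (size s); split; last first.
  rewrite card_eq_sym; apply/card_set_bijP; exists (nth 0%N s); split.
  - by move=> i /= si; apply/eqP; rewrite -sP mem_nth.
  - by move=> i j; rewrite !inE /= => si sj /eqP; rewrite nth_uniq// => /eqP.
  - move=> n /= /eqP; rewrite -sP => /(nthP 0%N)[i si <-]; by exists i.
pose f (i : 'I_(size s)) := e (nth 0%N s i).
have ff i j : dot (f i) (f j) = (i == j)%:R.
  by rewrite es_dot ?ls// nth_uniq.
exists f; split.
- by move=> i; rewrite /eigenspace_at /= (es_eigen es) ls.
- move=> c c0 i; have := dot0l dot (f i); rewrite -c0 dot_suml (bigD1 i)//=.
  rewrite dotZl ff eqxx mulr1 big1 ?addr0// => j ji.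
  by rewrite dotZl ff (negbTE ji) mulr0.
- move=> x Ax; exists (fun i => dot x (f i)).
  apply/eqP; rewrite -subr_eq0; set y := _ - _.
  have Ay : A y = t%:C *: y.
    rewrite /y (lin_sub lA) Ax (lin_sum lA) scalerBr scaler_sumr.
    congr (_ - _); apply: eq_bigr => i _.
    by rewrite (lin_scale lA) (es_eigen es) ls !scalerA mulrC.
  have yf i : dot y (f i) = 0.
    rewrite /y dotBl dot_suml (bigD1 i)//= dotZl ff eqxx mulr1 big1 ?addr0 ?subrr//.
    by move=> j ji; rewrite dotZl ff (negbTE ji) mulr0.
  have ye n : dot y (e n) = 0.
    have [lt|lt] := eqVneq (l n) t; last first.
      by apply: eigen_ortho Ay (es_eigen es n) _; rewrite eq_sym.
    have : n \in s by rewrite sP lt.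
    by move=> /(nthP 0%N)[i si <-]; apply: (yf (Ordinal si)).
  have := @es_max _ _ _ es N y (fun i _ => ye i).
  rewrite Ay rdotZl (rdot_self hdot) => h; apply/eqP/rnorm_eq0.
  apply: contrapT => /eqP y0.
  have : 0 < rnorm y ^+ 2 by rewrite exprn_gt0// lt_def y0 rnorm_ge0.
  nra.
Qed.

End Properties.
End EigenSystem.

(** * Norm bounds from the quadratic form, and orthonormal eigenvector families *)

Section FormBounds.
Context {R : realType} {H : completeNormedModType R[i]}.
Variables (dot : {dot H for conjC}) (hdot : hilbert_inner dot).
Local Notation rdot := (rdot dot).

(** Polarisation with [y] equal to [A x] rescaled to the length of [x]: then [<A x, y> = |x| |A x|],
    and the parallelogram law turns the bounds at [x + y] and [x - y] into [4 c |x|^2]. *)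
Lemma form_norm_bound (A : H -> H) (M : set H) (c : R) : linear A ->
  selfadjoint dot A -> closed_invariant A M -> 0 <= c ->
  (forall x, M x -> `|rdot (A x) x| <= c * rnorm x ^+ 2) ->
  forall x, M x -> rnorm (A x) <= c * rnorm x.
Proof.
move=> lA sA [MD MZ MA _] c0 hc x Mx.
have [Ax0|Ax0] := eqVneq (rnorm (A x)) 0.
  by rewrite Ax0 mulr_ge0 ?rnorm_ge0.
have Ap : 0 < rnorm (A x) by rewrite lt_def Ax0 rnorm_ge0.
have [x0|x0] := eqVneq (rnorm x) 0.
  by move: Ax0; rewrite (rnorm_eq0 x0) (lin_zero lA) rnorm0 eqxx.
have xp : 0 < rnorm x by rewrite lt_def x0 rnorm_ge0.
pose r := rnorm x / rnorm (A x); pose y := r%:C *: A x.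
have r0 : 0 <= r by rewrite divr_ge0 ?rnorm_ge0.
have My : M y by apply: MZ; apply: MA.
have Mxy : M (x - y) by apply: MD => //; rewrite -scaleN1r; apply: MZ.
have yn : rnorm y = rnorm x.
  by rewrite /y rnorm_realZ ger0_norm// divfK.
have pol : 4 * rdot (A x) y =
    rdot (A (x + y)) (x + y) - rdot (A (x - y)) (x - y).
  have := selfadjoint_rdot sA y x; rewrite (rdotC dot y) => h.
  clearbody y; rewrite (lin_add lA) (lin_sub lA) !(rdotDl, rdotDr, rdotNl, rdotNr) h.
  by ring.
have := hc _ (MD _ _ Mx My); have := hc _ Mxy; rewrite !ler_norml.
move=> /andP[h1 _] /andP[_ h2].
have := parallelogram hdot x y; rewrite yn => par.
have h : rdot (A x) y <= c * rnorm x ^+ 2.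
  rewrite -(ler_pM2l (ltr0Sn R 3)) pol.
  have := congr1 (fun z => c * z) par; lra.
move: h; rewrite /y rdotZr (rdot_self hdot) /r.
rewrite (_ : rnorm x / rnorm (A x) * rnorm (A x) ^+ 2 = rnorm x * rnorm (A x)); last by field.
by rewrite expr2 mulrCA ler_pM2l.
Qed.

Definition normsq (z : R[i]) : R := complex.Re (z * conjC z).

Lemma normsqE z : z * conjC z = (normsq z)%:C.
Proof. by apply: ge0_ReE; rewrite mul_conjC_ge0. Qed.

Lemma normsq_ge0 z : 0 <= normsq z.
Proof. by rewrite -lecR -normsqE mul_conjC_ge0. Qed.

Lemma normsq_gt0 z : z != 0 -> 0 < normsq z.
Proof. by move=> z0; rewrite -ltcR -normsqE mul_conjC_gt0. Qed.

Lemma conjC_real (r : R) : conjC r%:C = r%:C.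
Proof. by rewrite conjC_conjc /= oppr0. Qed.

Section OrthonormalFamily.
Variables (k : nat) (v : 'I_k -> H).
Hypothesis ov : forall i j, dot (v i) (v j) = (i == j)%:R.
Variable c : 'I_k -> R[i].

(** Two weights cover three cases: [(1, 1)] gives the norm, [(l, 1)] the quadratic form of [A], and
    [(l, l)] the norm of the image under [A]. *)
Lemma ortho_rdot (r s : 'I_k -> R) :
  rdot (\sum_i (r i)%:C *: (c i *: v i)) (\sum_i (s i)%:C *: (c i *: v i)) =
  \sum_i r i * s i * normsq (c i).
Proof.
have h : dot (\sum_i (r i)%:C *: (c i *: v i)) (\sum_i (s i)%:C *: (c i *: v i)) =
    (\sum_i r i * s i * normsq (c i))%:C.
  rewrite dot_suml rmorph_sum; apply: eq_bigr => i _.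
  rewrite dot_sumr (bigD1 i)//= big1 ?addr0.
    rewrite !(dotZl, dotZr) ov eqxx mulr1 conjC_real !rmorphM /= -normsqE.
    by ring.
  by move=> j ji; rewrite !(dotZl, dotZr) ov eq_sym (negbTE ji) !mulr0.
by rewrite /rdot h.
Qed.

Lemma ortho_rnorm : rnorm (\sum_i c i *: v i) ^+ 2 = \sum_i normsq (c i).
Proof.
have := ortho_rdot (fun=> 1) (fun=> 1).
under eq_bigr do rewrite scale1r.
by rewrite (rdot_self hdot) => ->; apply: eq_bigr => i _; rewrite !mul1r.
Qed.

Lemma ortho_neq0 : (exists i, c i != 0) -> 0 < rnorm (\sum_i c i *: v i).
Proof.
move=> [i ci]; rewrite lt_def rnorm_ge0 andbT -sqrf_eq0 ortho_rnorm.
rewrite psumr_neq0 => [|j _]; last exact: normsq_ge0.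
by apply/hasP; exists i; rewrite ?mem_index_enum//= normsq_gt0.
Qed.

Variables (A : H -> H) (l : 'I_k -> R).
Hypotheses (lA : linear A) (Av : forall i, A (v i) = (l i)%:C *: v i).

Lemma ortho_imageE :
  A (\sum_i c i *: v i) = \sum_i (l i)%:C *: (c i *: v i).
Proof.
rewrite (lin_sum lA); apply: eq_bigr => i _.
by rewrite (lin_scale lA) Av !scalerA mulrC.
Qed.

Lemma ortho_form_ge (t : R) : (forall i, t <= l i) ->
  t * rnorm (\sum_i c i *: v i) ^+ 2 <=
  rdot (A (\sum_i c i *: v i)) (\sum_i c i *: v i).
Proof.
move=> tl; have := ortho_rdot l (fun=> 1); rewrite -ortho_imageE.
under [in X in rdot _ X]eq_bigr do rewrite scale1r.
move=> ->; rewrite ortho_rnorm mulr_sumr; apply: ler_sum => i _.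
by rewrite mulr1 ler_wpM2r ?normsq_ge0.
Qed.

(** Absolute values allow a family mixing eigenvectors of both signs, as [sing_val_min] requires. *)
Lemma ortho_image_ge (t : R) : 0 <= t -> (forall i, t <= `|l i|) ->
  t * rnorm (\sum_i c i *: v i) <= rnorm (A (\sum_i c i *: v i)).
Proof.
move=> t0 tl; rewrite -ler_sqr ?nnegrE ?mulr_ge0 ?rnorm_ge0//.
rewrite exprMn ortho_rnorm -(rdot_self hdot) ortho_imageE ortho_rdot mulr_sumr.
apply: ler_sum => i _; rewrite ler_wpM2r ?normsq_ge0//.
by rewrite -expr2 -(real_normK (num_real (l i))) ler_sqr ?nnegrE.
Qed.

End OrthonormalFamily.
End FormBounds.

(** * Square root of a nonnegative compact operator *)

Section SquareRoot.
Context {R : realType} {H : completeNormedModType R[i]}.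
Variables (dot : {dot H for conjC}) (hdot : hilbert_inner dot).
Local Notation rdot := (rdot dot).

Lemma rcvg_rdot_eq (u v : nat -> H) a b x y : rcvg u a -> rcvg v b ->
  (forall n, rdot (u n) y = rdot x (v n)) -> rdot a y = rdot x b.
Proof.
move=> ua vb uv; apply/eqP; rewrite -subr_eq0 -normr_eq0 eq_le normr_ge0 andbT.
apply/ler_addgt0Pl => e e0; rewrite addr0.
have D0 : 0 < rnorm x + rnorm y + 1 by rewrite ltr_wpDl ?addr_ge0 ?rnorm_ge0.
have e1 : 0 < e / (rnorm x + rnorm y + 1) by rewrite divr_gt0.
have [N hN] := ua _ e1; have [M hM] := vb _ e1.
have := hN (N + M)%N (leq_addr _ _); have := hM (N + M)%N (leq_addl _ _).
set n := (N + M)%N; rewrite !ler_pdivlMr// => h1 h2.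
have -> : rdot a y - rdot x b = rdot x (v n - b) - rdot (u n - a) y.
  by rewrite rdotBl rdotBr uv; ring.
apply: le_trans (ler_normB _ _) _.
have := rdot_abs hdot x (v n - b); have := rdot_abs hdot (u n - a) y.
have := rnorm_ge0 (v n - b); have := rnorm_ge0 (u n - a).
have := rnorm_ge0 x; have := rnorm_ge0 y; nra.
Qed.

Lemma selfadjoint_dotE (T : H -> H) x : selfadjoint dot T ->
  dot (T x) x = (rdot (T x) x)%:C.
Proof.
move=> sT; have := sT x x; rewrite [RHS](dot_conj dot) conjC_conjc /rdot.
case: (dot (T x) x) => a b /= [] h; congr (_ +i* _)%C; lra.
Qed.

Variables (B : H -> H) (mu : nat -> R) (f : nat -> H).
Hypotheses (lB : linear B) (cB : seq_compact B) (sB : selfadjoint dot B).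
Hypothesis B0 : forall x, 0 <= rdot (B x) x.
Hypothesis es : eigen_system dot B mu f.

(** Weights 1 give the projection on the span of [f n, ..., f (m - 1)]; weights [sqrt (mu i)] give a
    section of the square root. A vanishing [f i] contributes nothing. *)
Definition spectral_sum (s : nat -> R) (n m : nat) (x : H) : H :=
  \sum_(n <= i < m) (s i)%:C *: (dot x (f i) *: f i).

Lemma spectral_sum_linear s n m : linear (spectral_sum s n m).
Proof.
move=> a x y; rewrite /spectral_sum scaler_sumr -big_split; apply: eq_bigr => i _.
by rewrite dotDl dotZl /= scalerDl scalerDr !scalerA !mulrA [a * _]mulrC.
Qed.

Lemma es_dot_unit x i : dot x (f i) * dot (f i) (f i) = dot x (f i).
Proof.
have := es_ge0 es i; rewrite le_eqVlt => /orP[/eqP/esym/(es_null es) ->|mi].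
  by rewrite dot0r mul0r.
by rewrite (es_dot hdot es _ mi) eqxx mulr1.
Qed.

Lemma dot_spectral_sum s n m i x :
  dot (spectral_sum s n m x) (f i) = ((n <= i < m)%:R * s i)%:C * dot x (f i).
Proof.
rewrite /spectral_sum dot_suml.
have hj j : j != i -> dot ((s j)%:C *: (dot x (f j) *: f j)) (f i) = 0.
  by move=> ji; rewrite !dotZl (es_ortho es ji) !mulr0.
have [nim|nim] := boolP (n <= i < m)%N; last first.
  rewrite mul0r mul0r big_nat big1// => j /= nj; apply: hj.
  by apply: contraNneq nim => <-.
rewrite (bigD1_seq i) ?mem_index_iota ?iota_uniq//= big1 ?addr0//.
by rewrite mul1r !dotZl es_dot_unit.
Qed.

Lemma spectral_sum_sa s n m : selfadjoint dot (spectral_sum s n m).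
Proof.
move=> x y; rewrite dot_suml dot_sumr; apply: eq_bigr => i _.
rewrite !(dotZl, dotZr) conjC_real [in RHS](dot_conj dot y) conjCK.
by ring.
Qed.

Lemma spectral_sum_comp s s' n m x :
  spectral_sum s n m (spectral_sum s' n m x) =
  spectral_sum (fun i => s i * s' i) n m x.
Proof.
rewrite /(spectral_sum s n m _) [RHS]/spectral_sum big_nat [RHS]big_nat.
apply: eq_bigr => i nim; rewrite dot_spectral_sum nim mul1r.
by rewrite !scalerA rmorphM mulrA.
Qed.

Lemma spectral_sum_form s n m x :
  rdot (spectral_sum s n m x) x = \sum_(n <= i < m) s i * normsq (dot x (f i)).
Proof.
have h : dot (spectral_sum s n m x) x =
    (\sum_(n <= i < m) s i * normsq (dot x (f i)))%:C.
  rewrite dot_suml rmorph_sum; apply: eq_bigr => i _.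
  by rewrite !dotZl (dot_conj dot (f i)) normsqE rmorphM.
by rewrite /rdot h.
Qed.

Lemma spectral_sum_rnorm s n m x :
  rnorm (spectral_sum s n m x) ^+ 2 =
  rdot (spectral_sum (fun i => s i * s i) n m x) x.
Proof.
rewrite -(rdot_self hdot) -spectral_sum_comp.
by rewrite (selfadjoint_rdot (spectral_sum_sa s n m)) rdotC.
Qed.

Lemma bessel n m x : \sum_(n <= i < m) normsq (dot x (f i)) <= rnorm x ^+ 2.
Proof.
pose P := spectral_sum (fun=> 1) n m x.
have E : rdot P x = \sum_(n <= i < m) normsq (dot x (f i)).
  by rewrite spectral_sum_form; apply: eq_bigr => i _; rewrite mul1r.
have P2 : rnorm P ^+ 2 = rdot P x.
  rewrite spectral_sum_rnorm; congr (rdot _ x); apply: eq_bigr => i _.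
  by rewrite mulr1.
rewrite -E; have := rdot_cauchy hdot P x; rewrite -P2.
have := rnorm_ge0 P; have := rnorm_ge0 x; nra.
Qed.

Lemma sqrt_sum_bound n m x :
  rnorm (spectral_sum (fun i => Num.sqrt (mu i)) n m x) <=
  Num.sqrt (mu n) * rnorm x.
Proof.
have mu0 i := es_ge0 es i.
rewrite -ler_sqr ?nnegrE ?mulr_ge0 ?rnorm_ge0 ?sqrtr_ge0//.
rewrite spectral_sum_rnorm spectral_sum_form exprMn sqr_sqrtr//.
apply: le_trans (_ : mu n * \sum_(n <= i < m) normsq (dot x (f i)) <= _).
  rewrite mulr_sumr big_nat [leRHS]big_nat; apply: ler_sum => i /andP[ni _].
  by rewrite ler_wpM2r ?normsq_ge0// -expr2 sqr_sqrtr// (es_mono hdot es ni).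
by rewrite ler_wpM2l ?bessel.
Qed.

Lemma sqrt_sum_cauchy x :
  rcauchy (fun n => spectral_sum (fun i => Num.sqrt (mu i)) 0 n x).
Proof.
move=> e e0; pose D := rnorm x + 1.
have D0 : 0 < D by rewrite ltr_wpDl ?rnorm_ge0.
have [|N hN] := es_cvg0 hdot es cB (r := (e / D) ^+ 2).
  by rewrite exprn_gt0 ?divr_gt0.
have wl m n : (N <= n)%N -> (n <= m)%N ->
    rnorm (spectral_sum (fun i => Num.sqrt (mu i)) 0 m x -
           spectral_sum (fun i => Num.sqrt (mu i)) 0 n x) <= e.
  move=> Nn nm; rewrite /spectral_sum (big_cat_nat (leq0n n) nm) /= addrAC subrr add0r.
  apply: le_trans (sqrt_sum_bound _ _ _) _.
  have h : Num.sqrt (mu n) <= e / D.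
    rewrite -ler_sqr ?nnegrE ?sqrtr_ge0 ?divr_ge0 ?(ltW e0) ?(ltW D0)//.
    rewrite sqr_sqrtr ?(es_ge0 es)//.
    exact: le_trans (es_mono hdot es Nn) (ltW hN).
  apply: le_trans (_ : e / D * D <= _); last by rewrite divfK ?gt_eqF.
  by rewrite ler_pM ?sqrtr_ge0 ?rnorm_ge0// lerDl.
exists N => m n Nm Nn; case: (leqP n m) => [nm|/ltnW mn]; first exact: wl.
by rewrite rnormBC; apply: wl.
Qed.

(** On the complement of [f 0, ..., f (n - 1)] the form of [B] lies between 0 and [mu n], so [B] has
    norm at most [mu n] there. The projections themselves need not converge to [x], since [B] may
    have a kernel; hence [B] is applied to them. *)
Lemma spectral_expansion x :
  rcvg (fun n => B (spectral_sum (fun=> 1) 0 n x)) (B x).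
Proof.
move=> e e0; pose D := 2 * rnorm x + 1.
have D0 : 0 < D by rewrite ltr_wpDl ?mulr_ge0 ?rnorm_ge0.
have [|N hN] := es_cvg0 hdot es cB (r := e / D); first by rewrite divr_gt0.
exists N => n Nn; rewrite -(lin_sub lB) -rnormN -(lin_opp lB) opprB.
set P := spectral_sum _ _ _ _.
have ev : eigenvectors B [seq f i | i <- iota 0 n].
  by move=> _ /mapP[i _ ->]; exists (mu i); exact: (es_eigen es).
have hP := orth_closed_invariant hdot sB ev.
have My : orth dot [seq f i | i <- iota 0 n] (x - P).
  move=> _ /mapP[i + ->]; rewrite mem_iota add0n => /= ni.
  by rewrite dotBl dot_spectral_sum ni mulr1 mul1r subrr.
have PX : rnorm P <= rnorm x.
  rewrite -ler_sqr ?nnegrE ?rnorm_ge0// spectral_sum_rnorm spectral_sum_form.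
  by apply: le_trans (bessel 0 n x); apply: ler_sum => i _; rewrite !mul1r.
apply: le_trans (form_norm_bound hdot lB sB hP (es_ge0 es n) _ My) _.
  move=> y hy; rewrite ger0_norm//; apply: (es_max es) => i ni; apply: hy.
  by apply/mapP; exists i; rewrite // mem_iota.
apply: le_trans (_ : e / D * D <= _); last by rewrite divfK ?gt_eqF.
rewrite ler_pM ?(es_ge0 es) ?rnorm_ge0//.
  by apply: le_trans (ltW hN); exact: (es_mono hdot es Nn).
have := ler_rnormD x (- P); rewrite rnormN /D; lra.
Qed.

Lemma sqrt_operator_exists : exists T, nonneg_operator dot T /\ T \o T = B.
Proof.
pose S n x := spectral_sum (fun i => Num.sqrt (mu i)) 0 n x.
have /choice[T hT] : forall x, exists y, rcvg (fun n => S n x) y.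
  by move=> x; apply: rcauchy_rcvg (sqrt_sum_cauchy x).
have lT : linear T.
  move=> a x y; apply: rcvg_unique (hT _) _.
  have := rcvgD (rcvgZ a (hT x)) (hT y); congr (rcvg _ _).
  by apply/funext => n; rewrite /S spectral_sum_linear.
have bT : rbounded T.
  exists (Num.sqrt (mu 0%N)) => [|x]; first exact: sqrtr_ge0.
  by apply: (rcvg_rnorm_le (hT x)) => n; exact: sqrt_sum_bound.
have sT : selfadjoint dot T.
  apply: dot_rdot_selfadjoint => // x y; apply: rcvg_rdot_eq (hT x) (hT y) _ => n.
  exact: selfadjoint_rdot (spectral_sum_sa _ _ _) _ _.
exists T; split; first split=> //.
- by split=> //; exact: rbounded_continuous.
- move=> x; rewrite selfadjoint_dotE// lecR -oppr_le0 -rdotNl -scaleN1r.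
  apply: (rcvg_rdot hdot (rcvgZ (-1) (hT x))) => n.
  rewrite scaleN1r rdotNl oppr_le0 spectral_sum_form; apply: sumr_ge0 => i _.
  by rewrite mulr_ge0 ?sqrtr_ge0 ?normsq_ge0.
apply/funext => x /=.
have Tf i : T (f i) = (Num.sqrt (mu i))%:C *: f i.
  apply: rcvg_unique (hT _) _ => e e0; exists i.+1 => n ni.
  rewrite (_ : S n (f i) = (Num.sqrt (mu i))%:C *: f i) ?subrr ?rnorm0 ?(ltW e0)//.
  rewrite /S /spectral_sum (bigD1_seq i) ?mem_index_iota ?iota_uniq//=.
  rewrite big1 ?addr0 => [|j ji].
    have := es_ge0 es i; rewrite le_eqVlt => /orP[/eqP/esym/(es_null es) ->|mi].
      by rewrite !scaler0.
    by rewrite (es_dot hdot es _ mi) eqxx scale1r.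
  by rewrite (es_ortho es) 1?eq_sym// scale0r scaler0.
(* Term by term, [T (S n x)] is [B] applied to the projection of [x], so the limits [T (T x)] and
   [B x] coincide. *)
apply: rcvg_unique (rcvg_image lT bT (hT x)) _.
have := spectral_expansion x; congr (rcvg _ _); apply/funext => n /=.
rewrite /S /spectral_sum (lin_sum lB) (lin_sum lT); apply: eq_bigr => i _.
rewrite !(lin_scale lB) !(lin_scale lT) (es_eigen es) Tf scale1r !scalerA.
by congr (_ *: _); rewrite mulrAC -rmorphM /= -expr2 sqr_sqrtr ?(es_ge0 es)// mulrC.
Qed.

End SquareRoot.

(** * Singular values, Weyl-type inequalities and the adjoint *)

Section SingularValues.
Context {R : realType} {H : completeNormedModType R[i]}.
Variables (dot : {dot H for conjC}) (hdot : hilbert_inner dot).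
Local Notation rdot := (rdot dot).

Lemma adjointP (A : H -> H) :
  (exists B : H -> H, forall x y, dot (A x) y = dot x (B y)) ->
  forall x y, dot (A x) y = dot x (adjoint dot A y).
Proof.
move=> ex.
exact: (getPex (P := [set B : H -> H | forall x y, dot (A x) y = dot x (B y)])) ex.
Qed.

Lemma dot_inj (y z : H) : (forall x, dot x y = dot x z) -> y = z.
Proof.
move=> h; apply/eqP; rewrite -subr_eq0; apply/eqP/rnorm_eq0/eqP.
by rewrite -sqrf_eq0 -(rdot_self hdot) /rdot dotBr h subrr.
Qed.

Lemma adjoint_selfadjoint (A : H -> H) : selfadjoint dot A -> adjoint dot A = A.
Proof.
move=> sA; apply/funext => y; apply: dot_inj => x.
by rewrite -adjointP ?sA//; exists A.
Qed.

Section Operator.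
Variable A : H -> H.
Hypotheses (lA : linear A) (cA : seq_compact A) (sA : selfadjoint dot A).

Lemma lambda_plus_system : exists e, eigen_system dot A (lambda_plus A) e.
Proof.
have [l [e es]] := eigen_system_exists hdot lA cA sA.
exists e; rewrite (lambda_plusE (es_pos_eigenvalue_seq hdot lA sA es cA)).
exact: es.
Qed.

(** Self-adjointness turns the operator under the root into [A \o A], which is compact with form
    [|A x|^2]; the spectral square root is then a witness for [get]. *)
Lemma abs_operatorP :
  nonneg_operator dot (abs_operator dot A) /\
  abs_operator dot A \o abs_operator dot A = A \o A.
Proof.
rewrite /abs_operator adjoint_selfadjoint// /sqrt_operator.
have lAA : linear (A \o A).
  by move=> a x y /=; rewrite (lin_add lA) (lin_scale lA) (lin_add lA) (lin_scale lA).
have sAA : selfadjoint dot (A \o A) by move=> x y /=; rewrite !sA.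
have [C C0 hC] := seq_compact_rbounded lA cA.
have cAA : seq_compact (A \o A).
  by apply: seq_compact_dominated C0 _ cA => x y /=; rewrite -(lin_sub lA).
have [mu [f es]] := eigen_system_exists hdot lAA cAA sAA.
have pos x : 0 <= rdot ((A \o A) x) x.
  by rewrite (selfadjoint_rdot sA) /= (rdot_self hdot) sqr_ge0.
exact: (getPex (P := [set T | nonneg_operator dot T /\ T \o T = A \o A]))
  (sqrt_operator_exists hdot lAA cAA sAA pos es).
Qed.

(** Both squares equal [<A (A x), x>]. This transfers compactness to the absolute value and lets its
    eigenvectors be tested against [A]. *)
Lemma abs_operator_rnorm x : rnorm (abs_operator dot A x) = rnorm (A x).
Proof.
have [[_ sT _] TT] := abs_operatorP.
apply/eqP; rewrite -(eqrXn2 (n := 2))// ?rnorm_ge0// -!(rdot_self hdot).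
rewrite (selfadjoint_rdot sT) (selfadjoint_rdot sA).
by have /= -> := congr1 (fun F => F x) TT.
Qed.

Lemma sing_val_system : exists g,
  eigen_system dot (abs_operator dot A) (sing_val dot A) g.
Proof.
have [[[lT _] sT _] _] := abs_operatorP; rewrite /sing_val.
have [|l [e es]] := eigen_system_exists hdot lT _ sT.
  apply: seq_compact_dominated ler01 _ cA => x y; rewrite mul1r.
  by rewrite -(lin_sub lT) -(lin_sub lA) abs_operator_rnorm.
exists e; rewrite (@lambda_plusE _ _ _ l)//.
apply: es_pos_eigenvalue_seq es _ => //.
apply: seq_compact_dominated ler01 _ cA => x y; rewrite mul1r.
by rewrite -(lin_sub lT) -(lin_sub lA) abs_operator_rnorm.
Qed.

Lemma sing_val_upper g n x :
  eigen_system dot (abs_operator dot A) (sing_val dot A) g ->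
  (forall i, (i < n)%N -> dot x (g i) = 0) -> rnorm (A x) <= sing_val dot A n * rnorm x.
Proof.
move=> es hx; have [[[lT _] sT pT] _] := abs_operatorP.
rewrite -abs_operator_rnorm.
have ev : eigenvectors (abs_operator dot A) [seq g i | i <- iota 0 n].
  by move=> _ /mapP[i _ ->]; exists (sing_val dot A i); exact: (es_eigen es).
apply: (form_norm_bound hdot lT sT (orth_closed_invariant hdot sT ev) (es_ge0 es n)).
  move=> y hy; rewrite ger0_norm; last first.
    by have := pT y; rewrite (selfadjoint_dotE _ sT) lecR.
  apply: (es_max es) => i ni; apply: hy.
  by apply/mapP; exists i; rewrite // mem_iota.
by move=> _ /mapP[i + ->]; rewrite mem_iota add0n => /= ni; apply: hx.
Qed.

End Operator.

Lemma es_family (A : H -> H) l e n : eigen_system dot A l e -> 0 < l n ->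
  forall i j : 'I_n.+1, dot (e i) (e j) = (i == j)%:R.
Proof.
move=> es ln i j; rewrite (es_dot hdot es)//.
by apply: lt_le_trans ln (es_mono hdot es _); rewrite -ltnS.
Qed.

Section Splitting.
Variables (A : H -> H) (lp lm : nat -> R) (ep em : nat -> H).
Hypotheses (lA : linear A) (cA : seq_compact A) (sA : selfadjoint dot A).
Hypotheses (esp : eigen_system dot A lp ep)
           (esm : eigen_system dot (fun x => - A x) lm em).

Lemma neg_eigen j : A (em j) = (- lm j)%:C *: em j.
Proof. by rewrite rmorphN /= scaleNr -(es_eigen esm) opprK. Qed.

(** Among [n + m + 1] eigenvectors of the absolute value some combination is orthogonal to [n]
    positive and [m] negative eigenvectors of [A]. There the form of [A] lies between [- lm m] and
    [lp n], which bounds [|A x|] by the maximum. *)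
Lemma sing_val_max n m : sing_val dot A (n + m)%N <= maxr (lp n) (lm m).
Proof.
have [g es] := sing_val_system lA cA sA.
have [[[lT _] _ _] _] := abs_operatorP lA cA sA.
set t := maxr _ _; rewrite leNgt; apply/negP => ts.
have t0 : 0 <= t by rewrite le_max (es_ge0 esp).
have sp : 0 < sing_val dot A (n + m)%N by exact: le_lt_trans ts.
pose w := [seq ep i | i <- iota 0 n] ++ [seq em i | i <- iota 0 m].
pose v (i : 'I_(n + m).+1) := g i.
have [|c [c0 hc]] := orthogonal_combination dot v (w := w).
  by rewrite size_cat !size_map !size_iota.
have ov := es_family es sp.
have xp := ortho_neq0 hdot ov c0; set x := \sum_i _ in hc xp.
have ev : eigenvectors A w.
  move=> f; rewrite mem_cat => /orP[] /mapP[i _ ->].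
    by exists (lp i); exact: (es_eigen esp).
  by exists (- lm i); exact: neg_eigen.
have up : rnorm (A x) <= t * rnorm x.
  apply: (form_norm_bound hdot lA sA (orth_closed_invariant hdot sA ev) t0) => //.
  move=> y hy; rewrite ler_norml -mulNr; apply/andP; split.
    rewrite mulNr lerNl -rdotNl; apply: le_trans (_ : lm m * rnorm y ^+ 2 <= _).
      apply: (es_max esm) => i im; apply: hy; rewrite mem_cat; apply/orP; right.
      by apply/mapP; exists i; rewrite // mem_iota.
    by rewrite ler_wpM2r ?sqr_ge0// le_max lexx orbT.
  apply: le_trans (_ : lp n * rnorm y ^+ 2 <= _).
    apply: (es_max esp) => i im; apply: hy; rewrite mem_cat; apply/orP; left.
    by apply/mapP; exists i; rewrite // mem_iota.
  by rewrite ler_wpM2r ?sqr_ge0// le_max lexx.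
have low : sing_val dot A (n + m)%N * rnorm x <= rnorm (A x).
  rewrite -(abs_operator_rnorm lA cA sA).
  apply: (ortho_image_ge hdot ov _ lT (l := fun i => sing_val dot A i)) => //.
  - by move=> i; exact: (es_eigen es).
  - exact: ltW.
  - move=> i; rewrite ger0_norm ?(es_ge0 es)//.
    by apply: (es_mono hdot es); rewrite -ltnS.
by have := le_trans low up; rewrite ler_pM2r// leNgt ts.
Qed.

(** The first [n + 1] positive and [m + 1] negative eigenvectors form an orthonormal family of size
    [n + m + 2], one more than the [n + m + 1] conditions defining the complement on which
    [sing_val dot A (n + m).+1] bounds [A]. *)
Lemma sing_val_min n m : minr (lp n) (lm m) <= sing_val dot A (n + m).+1.
Proof.
have [g es] := sing_val_system lA cA sA.
set t := minr _ _; rewrite leNgt; apply/negP => ts.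
have t0 : 0 < t by apply: le_lt_trans ts; exact: (es_ge0 es).
have [lpn lmm] : 0 < lp n /\ 0 < lm m by apply/andP; rewrite -lt_min.
have tp i : (i <= n)%N -> t <= lp i.
  by move=> /(es_mono hdot esp); apply: le_trans; rewrite ge_min lexx.
have tm i : (i <= m)%N -> t <= lm i.
  by move=> /(es_mono hdot esm); apply: le_trans; rewrite ge_min lexx orbT.
have hpm i j : (i <= n)%N -> (j <= m)%N -> dot (ep i) (em j) = 0.
  move=> /tp hi /tm hj; apply: (eigen_ortho sA (es_eigen esp i) (neg_eigen j)).
  by apply/eqP; lra.
pose v (i : 'I_(n.+1 + m.+1)) :=
  match fintype.split i with inl a => ep a | inr b => em b end.
pose l (i : 'I_(n.+1 + m.+1)) :=
  match fintype.split i with inl a => lp a | inr b => - lm b end.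
have ov i j : dot (v i) (v j) = (i == j)%:R.
  rewrite /v -(can_eq (@splitK _ _)).
  case: (fintype.split i) (fintype.split j) => a [] b.
  - by rewrite (es_family esp lpn).
  - by rewrite hpm// -ltnS.
  - by apply: dot_sym0; rewrite hpm// -ltnS.
  - by rewrite (es_family esm lmm).
have Av i : A (v i) = (l i)%:C *: v i.
  by rewrite /v /l; case: (fintype.split i) => a; [exact: (es_eigen esp)|exact: neg_eigen].
have tl i : t <= `|l i|.
  rewrite /l; case: (fintype.split i) => a; rewrite ?normrN ger0_norm ?(es_ge0 esp) ?(es_ge0 esm)//.
    by rewrite tp// -ltnS.
  by rewrite tm// -ltnS.
have [|c [c0 hc]] := orthogonal_combination dot v (w := [seq g i | i <- iota 0 (n + m).+1]).
  by rewrite size_map size_iota addSn addnS.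
have xp := ortho_neq0 hdot ov c0.
have low := ortho_image_ge hdot ov c lA Av (ltW t0) tl.
set x := \sum_i _ in hc xp low.
have up : rnorm (A x) <= sing_val dot A (n + m).+1 * rnorm x.
  apply: (sing_val_upper lA cA sA es) => i ni; apply: hc.
  by apply/mapP; exists i; rewrite // mem_iota.
by have := le_trans low up; rewrite ler_pM2r// leNgt ts.
Qed.

End Splitting.

(* [V] plays the role of [U^*]: the quadratic form of [A] is that of [A'],
   transported by a unitary, up to the perturbation [K]. *)
Lemma weyl_transported (A A' K U V : H -> H) (l l' k : nat -> R) (e e' g : nat -> H) :
  linear A -> eigen_system dot A l e -> eigen_system dot A' l' e' ->
  (forall m, 0 <= k m) ->
  (forall m x, (forall i, (i < m)%N -> dot x (g i) = 0) -> rnorm (K x) <= k m * rnorm x) ->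
  (forall x y, dot (V x) y = dot x (U y)) -> (forall x, rnorm (V x) = rnorm x) ->
  (forall x, rdot (A x) x <= rdot (A' (V x)) (V x) + rnorm (K x) * rnorm x) ->
  forall n m, l (n + m)%N <= l' n + k m.
Proof.
move=> lA es es' k0 hK VU Vn hA n m; rewrite leNgt; apply/negP => lt.
have lp : 0 < l (n + m)%N by apply: le_lt_trans lt; rewrite addr_ge0// (es_ge0 es').
(* Orthogonality of [V x] to [e' i] is pulled back to orthogonality of [x] to [U (e' i)]. *)
pose w := [seq U (e' i) | i <- iota 0 n] ++ [seq g i | i <- iota 0 m].
pose v (i : 'I_(n + m).+1) := e i.
have [|c [c0 hc]] := orthogonal_combination dot v (w := w).
  by rewrite size_cat !size_map !size_iota.
have ov := es_family es lp.
have xp := ortho_neq0 hdot ov c0.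
have low : l (n + m)%N * rnorm (\sum_i c i *: v i) ^+ 2 <=
    rdot (A (\sum_i c i *: v i)) (\sum_i c i *: v i).
  apply: (ortho_form_ge hdot ov _ lA (l := fun i => l i)) => i.
    exact: (es_eigen es).
  by apply: (es_mono hdot es); rewrite -ltnS.
set x := \sum_i _ in hc xp low.
have h1 : rdot (A' (V x)) (V x) <= l' n * rnorm x ^+ 2.
  rewrite -(Vn x); apply: (es_max es') => i ni; rewrite VU; apply: hc.
  by rewrite mem_cat; apply/orP; left; apply/mapP; exists i; rewrite // mem_iota.
have h2 : rnorm (K x) <= k m * rnorm x.
  apply: hK => i im; apply: hc.
  by rewrite mem_cat; apply/orP; right; apply/mapP; exists i; rewrite // mem_iota.
have h3 : rnorm (K x) * rnorm x <= k m * rnorm x ^+ 2.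
  by rewrite expr2 mulrA ler_wpM2r ?rnorm_ge0.
have : l (n + m)%N * rnorm x ^+ 2 <= (l' n + k m) * rnorm x ^+ 2.
  by apply: le_trans low _; apply: le_trans (hA x) _; rewrite mulrDl lerD.
by rewrite ler_pM2r ?exprn_gt0// leNgt lt.
Qed.

(* Riesz representation of [x |-> <U x, y>], obtained by minimising
   [|x|^2 / 2 - Re <U x, y>]. *)
Lemma real_adjoint_exists (U : H -> H) y : linear U -> rbounded U ->
  exists z, forall x, rdot (U x) y = rdot x z.
Proof.
move=> lU [C C0 hC].
pose J x := rnorm x ^+ 2 / 2 - rdot (U x) y.
pose D := C * rnorm y.
(* With [r = |x|], [J x >= r^2 / 2 - D r], whose minimum is at [r = D]. *)
have Jlow x : - (D ^+ 2 / 2) <= J x.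
  have := rdot_cauchy hdot (U x) y.
  have : rnorm (U x) * rnorm y <= D * rnorm x.
    by rewrite /D mulrAC ler_wpM2r ?rnorm_ge0.
  have := sqr_ge0 (rnorm x - D); rewrite /J; nra.
pose S := range J.
have Sinf : has_inf S.
  by split; [exists (J 0); exists 0|exists (- (D ^+ 2 / 2)) => _ [x _ <-]].
pose j := inf S.
have jJ x : j <= J x by apply: ge_inf; [exact: Sinf.2|exists x].
have /choice[u hu] : forall n : nat, exists x, J x < j + n.+1%:R^-1.
  move=> n; have n0 : 0 < n.+1%:R^-1 :> R by [].
  by have [_ [x _ <-] h] := inf_adherent n0 Sinf; exists x.
have JD (x z : H) t : J (x + t%:C *: z) =
    J x + t * (rdot x z - rdot (U z) y) + t ^+ 2 * (rnorm z ^+ 2 / 2).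
  rewrite /J -!(rdot_self hdot) (lin_add lU) (lin_scale lU).
  by rewrite !(rdotDl, rdotDr, rdotZl, rdotZr) (rdotC dot z x); field.
have cu : rcauchy u.
  (* By the parallelogram law [|u m - u n|^2 / 4] is the sum of [J] at both points minus twice [J]
     at the midpoint, hence at most [2 (e^2 / 8)]. *)
  move=> e e0; exists (Num.truncn (8 / e ^+ 2)) => m n hm hn.
  have small i : (Num.truncn (8 / e ^+ 2) <= i)%N -> i.+1%:R^-1 <= e ^+ 2 / 8.
    move=> hi; rewrite -[e ^+ 2 / 8]invrK lef_pV2 ?posrE ?invr_gt0 ?divr_gt0 ?exprn_gt0//.
    rewrite invf_div; apply: le_trans (ltW (truncnS_gt _)) _; by rewrite ler_nat ltnS.
  have := small _ hm; have := small _ hn; have := hu m; have := hu n.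
  move: (n.+1%:R^-1) (m.+1%:R^-1) => a b hb ha h1 h2.
  have := jJ ((2^-1)%:C *: (u m + u n)).
  rewrite {1}/J rnorm_realZ (lin_scale lU) (lin_add lU) rdotZl rdotDl.
  rewrite gtr0_norm ?invr_gt0// => hmid.
  have := parallelogram hdot (u m) (u n); rewrite /J in ha hb => par.
  rewrite -ler_sqr ?nnegrE ?rnorm_ge0 ?(ltW e0)//.
  by move: hmid; rewrite exprMn; lra.
have [z uz] := rcauchy_rcvg cu.
exists z => x.
(* Near-minimality makes a quadratic polynomial in [t] nonnegative: moving [u n] along [x] lowers
   [J] by less than [1/(n + 1)]. Its discriminant bounds the derivative of [J] at [u n]. *)
have var n : ((rdot (u n) x - rdot (U x) y) / 2) ^+ 2 <=
    n.+1%:R^-1 * (rnorm x ^+ 2 / 2).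
  apply: discriminant_le => [||t]; [by []|by rewrite divr_ge0 ?sqr_ge0|].
  have := jJ (u n + t%:C *: x); rewrite JD.
  have := hu n; move: (n.+1%:R^-1) => a; nra.
rewrite (rdotC dot x); apply/esym/eqP; rewrite -subr_eq0 -normr_eq0.
rewrite eq_le normr_ge0 andbT; apply/ler_addgt0Pl => e e0; rewrite addr0.
have x1 : 0 < rnorm x + 1 by rewrite ltr_wpDl ?rnorm_ge0.
have [|N hN] := uz (e / 2 / (rnorm x + 1)); first by rewrite !divr_gt0.
pose n := (N + Num.truncn (8 * rnorm x ^+ 2 / e ^+ 2))%N.
have := hN n (leq_addr _ _); rewrite ler_pdivlMr// => h1.
have h2 : `|rdot (u n) x - rdot (U x) y| <= e / 2.
  rewrite -ler_sqr ?nnegrE ?normr_ge0 ?divr_ge0 ?(ltW e0)//.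
  rewrite real_normK ?num_real//.
  have : 8 * rnorm x ^+ 2 / e ^+ 2 <= n.+1%:R.
    apply: le_trans (ltW (truncnS_gt _)) _; by rewrite ler_nat ltnS leq_addl.
  rewrite ler_pdivrMr ?exprn_gt0// => h3.
  have := var n; rewrite [leRHS]mulrC ler_pdivlMr// => h4.
  rewrite -(ler_pM2r (ltr0Sn R n)); move: (n.+1%:R) h3 h4 => a; lra.
have h5 := rdot_abs hdot (u n - z) x.
have -> : rdot z x - rdot (U x) y =
    (rdot (u n) x - rdot (U x) y) - rdot (u n - z) x by rewrite rdotBl; ring.
apply: le_trans (ler_normB _ _) _; have := rnorm_ge0 (u n - z); lra.
Qed.

Lemma adjoint_exists (U : H -> H) : linear U -> rbounded U ->
  exists B : H -> H, forall x y, dot (U x) y = dot x (B y).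
Proof.
move=> lU bU; have /choice[B hB] := fun y => real_adjoint_exists y lU bU.
exists B => x y; apply: rdot_ext => a.
by rewrite -(lin_scale lU) hB.
Qed.

End SingularValues.

Theorem theorem2p7 (R : realType) (H : completeNormedModType R[i])
    (dot : {dot H for conjC}) (hdot : hilbert_inner dot)
    (p : R) (hp : 0 < p) (A : H -> H)
    (hAc : compact_operator A) (hAs : selfadjoint dot A)
    (hU : exists U : H -> H, unitary dot U /\
       S0 dot p (fun x => U (A (adjoint dot U x)) + A x)) :
  [/\ Delta_plus p A = Delta_minus p A,
      Delta_minus p A = ((2^-1)%:E * Delta dot p A)%E,
      delta_plus p A = delta_minus p A &
      delta_minus p A = ((2^-1)%:E * delta dot p A)%E].
Proof.
have [U [[[lU cU] VU UV] [hKc uK]]] := hU.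
have lA := hAc.1; have cA := compact_seq_compact hAc.
have bU := continuous_rbounded lU cU.
have adjU := adjointP (adjoint_exists hdot lU bU).
set V := adjoint dot U in VU UV hKc uK adjU.
pose K x := U (A (V x)) + A x.
have VUdot x y : dot (V x) y = dot x (U y).
  by rewrite (dot_conj dot) -adjU -(dot_conj dot).
(* [U \o V = id] is the relation used: [<V x, V x> = <x, U (V x)>]. *)
have Vn x : rnorm (V x) = rnorm x.
  apply/eqP; rewrite -(eqrXn2 (n := 2))// ?rnorm_ge0// -!(rdot_self hdot) /rdot.
  by rewrite VUdot; have /= -> := congr1 (fun F => F x) UV.
have sK : selfadjoint dot K.
  by move=> x y; rewrite /K dotDl dotDr adjU hAs -VUdot hAs.
have lK : linear K by exact: hKc.1.
have cK : seq_compact K by exact: compact_seq_compact hKc.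
have lmA : linear (fun x => - A x).
  by move=> a x y; rewrite (lin_add lA) (lin_scale lA) opprD scalerN.
have cmA : seq_compact (fun x => - A x).
  apply: seq_compact_dominated ler01 _ cA => x y.
  by rewrite -opprD rnormN mul1r.
have smA : selfadjoint dot (fun x => - A x).
  by move=> x y; rewrite dotNl dotNr hAs.
have [ep esp] := lambda_plus_system hdot lA cA hAs.
have [em esm] := lambda_plus_system hdot lmA cmA smA.
have [g esK] := sing_val_system hdot lK cK sK.
have [f esA] := sing_val_system hdot lA cA hAs.
have KA x : rdot dot (K x) x = rdot dot (A (V x)) (V x) + rdot dot (A x) x.
  by rewrite /K rdotDl /rdot adjU.
have hK m x : (forall i, (i < m)%N -> dot x (g i) = 0) ->
    rnorm (K x) <= sing_val dot K m * rnorm x.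
  exact: sing_val_upper.
apply: (asymp_balance hp (k := sing_val dot K)).
- exact: (es_ge0 esp).
- exact: (es_ge0 esm).
- exact: (es_ge0 esA).
- exact: (es_ge0 esK).
- by move=> m n; exact: (es_mono hdot esA).
- exact: uK.
(* By [KA] the form of [A] at [x] is that of [- A] at [V x] plus [<K x, x>]. Exchanging [A] and
   [- A] flips the sign of the last term, so the mirror case needs the lower bound on it. *)
- apply: (weyl_transported hdot lA esp esm (es_ge0 esK) hK VUdot Vn) => x.
  by have := rdot_cauchy hdot (K x) x; rewrite KA rdotNl; lra.
- apply: (weyl_transported hdot lmA esm esp (es_ge0 esK) hK VUdot Vn) => x.
  have := rdot_abs hdot (K x) x; rewrite ler_norml KA rdotNl => /andP[]; lra.
- by move=> n m; exact: (sing_val_max hdot lA cA hAs esp esm).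
- by move=> n m; exact: (sing_val_min hdot lA cA hAs esp esm).
Qed.
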